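(* Let $\mathcal F=LF(F)$ be a saturated formation such that $\mathcal N\subseteq\mathcal F\subseteq\mathcal U$, where $F$ is the canonical local satellite of $\mathcal F$. Let $n\ge 1$ and let $G$ be a finite soluble group with $|\pi(G)|\ge n+1$. Then all $n$-maximal subgroups of $G$ are $\mathcal F$-subnormal in $G$ if and only if $G$ is a group of one of the following types: I. $G\in\mathcal F$. II. $G=A\rtimes B$, where $A=G^{\mathcal F}$ and $B$ are Hall subgroups of $G$, while $G$ is Ore dispersive and satisfies the following: (1) $A$ is either of the form $N_1\times\dots\times N_t$, where each $N_i$ ($i=1,\dots,t$) is a minimal normal subgroup of $G$ which is a Sylow subgroup of $G$, or a Sylow $p$-subgroup of $G$ of exponent $p$ for some prime $p$ such that the commutator subgroup, the Frattini subgroup and the center of $A$ coincide, while $A/\Phi(A)$ is an $\mathcal F$-eccentric chief factor of $G$; (2) every $n$-maximal subgroup $H$ of $G$ belongs to $\mathcal F$ and, for every prime divisor $p$ of $|A|$, induces on the Sylow $p$-subgroup $P$ of $A$ an automorphism group which is contained in $F(p)$, that is, $H/C_H(P)\in F(p)$.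
   Context: All groups are finite. $\pi(G)$ is the set of prime divisors of $|G|$; $\mathcal N$ and $\mathcal U$ are the classes of all nilpotent and all supersoluble groups; $\mathcal G_p$ is the class of all $p$-groups; $\Phi(X)$ is the Frattini subgroup of $X$. For a class $\mathcal F$ of groups with $1\in\mathcal F$, $G^{\mathcal F}$ is the intersection of all normal subgroups $N$ of $G$ with $G/N\in\mathcal F$. A class $\mathcal F$ is a formation if either $\mathcal F=\emptyset$, or $1\in\mathcal F$ and every homomorphic image of $G/G^{\mathcal F}$ belongs to $\mathcal F$ for any group $G$. A formation $\mathcal F$ is saturated if $G/\Phi(G)\in\mathcal F$ implies $G\in\mathcal F$ for any group $G$. For a function $f$ assigning to each prime $p$ a formation $f(p)$, $LF(f)$ is the class of all groups $G$ such that either $G=1$, or $G\ne1$ and $G/C_G(H/K)\in f(p)$ for every chief factor $H/K$ of $G$ and every prime $p$ dividing $|H/K|$. For every non-empty saturated formation $\mathcal F$ there is a unique such function $F$ with $\mathcal F=LF(F)$ and $F(p)=\mathcal G_pF(p)\subseteq\mathcal F$ for all primes $p$, where $\mathcal G_pF(p)$ is the class of all groups $X$ with $X^{F(p)}\in\mathcal G_p$; $F$ is called the canonical local satellite of $\mathcal F$. A chief factor $H/K$ of $G$ is $\mathcal F$-central in $G$ if $G/C_G(H/K)\in F(p)$ for all primes $p$ dividing $|H/K|$; otherwise it is $\mathcal F$-eccentric. $G$ is Ore dispersive if, writing $|G|=p_1^{\alpha_1}\cdots p_m^{\alpha_m}$ with primes $p_1>p_2>\dots>p_m$, for every $i$ there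 is a normal subgroup of $G$ of order $p_1^{\alpha_1}\cdots p_i^{\alpha_i}$. A $1$-maximal subgroup of $G$ is a maximal subgroup of $G$; for $n\ge2$, an $n$-maximal subgroup of $G$ is a maximal subgroup of some $(n-1)$-maximal subgroup of $G$. For a non-empty formation $\mathcal F$, a subgroup $H$ of $G$ is $\mathcal F$-subnormal in $G$ if either $H=G$ or there is a chain $H=H_0<H_1<\dots<H_k=G$ such that, for $i=1,\dots,k$, $H_{i-1}$ is a maximal subgroup of $H_i$ and $H_i/(H_{i-1})_{H_i}\in\mathcal F$, where $(H_{i-1})_{H_i}$ is the core of $H_{i-1}$ in $H_i$ (the largest normal subgroup of $H_i$ contained in $H_{i-1}$). *)

(* Defs.v *)
From HB Require Import structures.
From mathcomp Require Import all_boot all_fingroup all_solvable.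
From mathcomp Require Import boolp.

Set Implicit Arguments.
Unset Strict Implicit.
Unset Printing Implicit Defensive.

Import GroupScope.

Record group_class := GroupClass {
  in_class :> forall gT : finGroupType, {group gT} -> Prop;
  in_class_isog : forall (gT rT : finGroupType)
    (G : {group gT}) (H : {group rT}),
    G \isog H -> @in_class gT G -> @in_class rT H
}.

Definition sub_class (F1 F2 : forall gT : finGroupType, {group gT} -> Prop) :=
  forall (gT : finGroupType) (G : {group gT}), F1 gT G -> F2 gT G.

Definition eq_class (F1 F2 : forall gT : finGroupType, {group gT} -> Prop) :=
  forall (gT : finGroupType) (G : {group gT}), F1 gT G <-> F2 gT G.

Definition nilpotent_groups (gT : finGroupType) (G : {group gT}) : Prop :=
  nilpotent G.

(* G has a series 1 = G_0 <= G_1 <= ... <= G_s = G of normal subgroups of G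
   with cyclic factors. *)
Definition supersoluble (gT : finGroupType) (G : {group gT}) : Prop :=
  exists2 s : seq {group gT},
    path (fun K H : {group gT} =>
            [&& K \subset H, H <| G & cyclic (H / K)]) 1%G s
    & last 1%G s = G.

Definition residual (F : group_class) (gT : finGroupType) (G : {group gT}) :
    {group gT} :=
  (\bigcap_(N : {group gT} | (N <| G) && `[< F _ (G / N)%G >]) N)%G.

(* Homomorphic images are images under morphisms with domain G / G^F. *)
Definition formation (F : group_class) : Prop :=
  (forall (gT : finGroupType) (G : {group gT}), ~ F _ G) \/
  ((forall gT : finGroupType, F _ [1 gT]%G) /\
   (forall (gT rT : finGroupType) (G : {group gT})
      (f : {morphism G / residual F G >-> rT}),
      F _ (f @* (G / residual F G))%G)).

Definition saturated (F : group_class) : Prop :=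
  forall (gT : finGroupType) (G : {group gT}), F _ (G / 'Phi(G))%G -> F _ G.

(* LF(f); only the values of f at primes matter. *)
Definition LF (f : nat -> group_class) (gT : finGroupType) (G : {group gT}) :
    Prop :=
  G :=: 1 \/
  (G :!=: 1 /\
   forall H K : {group gT}, chief_factor G K H ->
   forall p : nat, prime p -> p %| #|H / K| ->
     f p _ (G / 'C_G(H / K | 'Q))%G).

(* The class of all X with X^F a p-group; the residual only makes sense when F
   contains the trivial groups, and the class is empty when F is. *)
Definition pgroup_by (p : nat) (F : group_class)
    (gT : finGroupType) (X : {group gT}) : Prop :=
  F _ [1 gT]%G /\ p.-group (residual F X).

Definition canonical_satellite (F : group_class) (f : nat -> group_class) :
    Prop :=
  [/\ forall p, prime p -> formation (f p),
      eq_class F (LF f),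
      forall p, prime p -> eq_class (f p) (pgroup_by p (f p))
    & forall p, prime p -> sub_class (f p) F].

(* F-centrality of the chief factor H / K of G, f being the canonical local
   satellite of F. *)
Definition central_chief (f : nat -> group_class) (gT : finGroupType)
    (G H K : {group gT}) : Prop :=
  chief_factor G K H /\
  forall p : nat, prime p -> p %| #|H / K| -> f p _ (G / 'C_G(H / K | 'Q))%G.

Definition eccentric_chief (f : nat -> group_class) (gT : finGroupType)
    (G H K : {group gT}) : Prop :=
  chief_factor G K H /\ ~ central_chief f G H K.

(* For p = p_i in p_1 > ... > p_m, the order of N below is
   p_1^a_1 * ... * p_i^a_i. *)
Definition Ore_dispersive (gT : finGroupType) (G : {group gT}) : Prop :=
  forall p : nat, p \in \pi(G) ->
  exists2 N : {group gT}, N <| G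
    & #|N| = (\prod_(q <- primes #|G| | p <= q) q ^ logn q #|G|)%N.

(* With the convention that G is its own 0-maximal subgroup. *)
Fixpoint n_maximal (n : nat) (gT : finGroupType) (H G : {group gT}) : Prop :=
  if n is m.+1 then exists2 M : {group gT}, n_maximal m M G & maximal H M
  else H = G.

Inductive F_subnormal (F : group_class) (gT : finGroupType) (G : {group gT}) :
    {group gT} -> Prop :=
| F_subnormal_refl : F_subnormal F G G
| F_subnormal_step (H M : {group gT}) :
    maximal H M -> F _ (M / gcore H M)%G -> F_subnormal F G M ->
    F_subnormal F G H.

(* Main.v *)
(* The wreath product of a group of order p by a group X in f(p) lies in
   G_p f(p) = f(p), hence is supersoluble, so X is an extension of a p-group by
   an abelian group of exponent dividing p - 1.  A formation of such abelian
   groups consists of all those of exponent dividing some m_p | p - 1, hence f(p)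
   is the class of all X whose verbal subgroup X'X^{m_p} is a p-group, and F is
   the class of all soluble G in which G'G^{m_p} is p-nilpotent for every p.  In
   particular F and all f(p) are hereditary.

   Put n = k + 1.  If all n-maximal subgroups are F-subnormal, saturation puts
   every subgroup lying at the bottom of a chain of k proper inclusions in F.  As
   G has at least k + 2 prime divisors, this applies to all subgroups of order
   divisible by at most two primes, to proper subgroups of those with three, and
   so on.  Call p bad if G'G^{m_p} is not p-nilpotent, and let the p'-group D act
   on a Sylow p-subgroup P for a bad p, where all prime divisors of |D| are
   smaller than p.  Then D'D^{m_p} acts trivially on the proper D-invariant
   subgroups of P but not on P, which makes P normal in G and P / Phi(P) an
   eccentric chief factor.  The product of the Sylow subgroups for bad primes is
   the residual, and if some Phi(P) is nontrivial there is room in the chains to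
   show that P is the only one, and special of exponent p. *)

Require Import Defs.
From mathcomp Require Import all_boot all_fingroup all_solvable.
From mathcomp Require Import ssralg zmodp matrix mxrepresentation mxabelem.
From mathcomp Require Import boolp zify.

Set Implicit Arguments.
Unset Strict Implicit.
Unset Printing Implicit Defensive.

Import GroupScope.

(** * Residuals for abelian groups of bounded exponent, and p-nilpotency *)

Section AbelianResidual.

Variable m : nat.

(** The verbal subgroup [G'G^m]: for a group [G], the smallest normal subgroup with abelian quotient
    of exponent dividing [m]. *)
Definition abres (gT : finGroupType) (G : {set gT}) : {set gT} :=
  <<commg_set G G :|: [set x ^+ m | x in G]>>.

Canonical abres_group (gT : finGroupType) (G : {set gT}) :=
  Eval hnf in [group of abres G].

Variables gT : finGroupType.
Implicit Types G H K : {group gT}.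

Lemma abresS (A B : {set gT}) : A \subset B -> abres A \subset abres B.
Proof. by move=> sAB; rewrite genS // setUSS ?imset2S ?imsetS. Qed.

Lemma mem_abres_commg (A : {set gT}) x y :
  x \in A -> y \in A -> [~ x, y] \in abres A.
Proof. by move=> Ax Ay; rewrite mem_gen // inE imset2_f. Qed.

Lemma mem_abres_exp (A : {set gT}) x : x \in A -> x ^+ m \in abres A.
Proof. by move=> Ax; rewrite mem_gen // inE orbC (imset_f (fun y => y ^+ m)). Qed.

Lemma abres_subP (A : {set gT}) H :
  reflect ({in A &, forall x y, [~ x, y] \in H} /\
           {in A, forall x, x ^+ m \in H})
          (abres A \subset H).
Proof.
apply: (iffP idP) => [/subsetP sAH | [sRH sXH]].
  split=> [x y Ax Ay | x Ax]; first exact/sAH/mem_abres_commg.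
  exact/sAH/mem_abres_exp.
rewrite gen_subG subUset; apply/andP; split; apply/subsetP=> z.
  by case/imset2P=> x y Ax Ay ->; apply: sRH.
by case/imsetP=> x Ax ->; apply: sXH.
Qed.

Lemma abres_sub G : abres G \subset G.
Proof. by apply/abres_subP; split=> [x y Gx Gy|x Gx]; rewrite ?groupR ?groupX. Qed.

Lemma der1_sub_abres G : G^`(1) \subset abres G.
Proof. by rewrite gen_subG sub_gen ?subsetUl. Qed.

Lemma abres_norm (A : {set gT}) : 'N(A) \subset 'N(abres A).
Proof.
rewrite (subset_trans _ (norm_gen _)) //; apply/subsetP=> z nAz.
rewrite inE; apply/subsetP=> _ /imsetP[t At ->]; move: At; rewrite !inE.
case/orP=> [/imset2P[x y Ax Ay ->] | /imsetP[x Ax ->]].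
  by rewrite conjRg imset2_f ?memJ_norm.
by rewrite conjXg orbC (imset_f (fun y => y ^+ m)) ?memJ_norm.
Qed.

Lemma abres_normal G : abres G <| G.
Proof. by rewrite /normal abres_sub (subset_trans (normG G)) ?abres_norm. Qed.

Lemma abres_trivP G :
  reflect (abelian G /\ {in G, forall x, x ^+ m = 1}) (abres G == 1).
Proof.
rewrite -subG1; apply: (iffP idP) => [/abres_subP[Rab Xab] | [ab Xab]].
  split=> [|x Gx]; last by apply/set1gP; apply: Xab.
  by apply/centsP=> x Gx y Gy; apply/commgP/eqP/set1gP; apply: Rab.
apply/(@abres_subP _ 1%G); split=> [x y Gx Gy | x Gx]; apply/set1gP.
  by apply/eqP/commgP/(centsP ab).
exact: Xab.
Qed.

End AbelianResidual.

Lemma morphim_abres m (aT rT : finGroupType) (D : {group aT})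
    (f : {morphism D >-> rT}) (G : {group aT}) :
  G \subset D -> f @* abres m G = abres m (f @* G).
Proof.
move=> sGD; have Dm x : x \in G -> x \in D by apply: subsetP.
apply/eqP; rewrite eqEsubset; apply/andP; split.
  rewrite sub_morphim_pre; last exact: subset_trans (abres_sub m G) sGD.
  apply/abres_subP; split=> [x y Gx Gy | x Gx].
    have [Dx Dy] := (Dm x Gx, Dm y Gy); rewrite mem_morphpre ?groupR //.
    by rewrite morphR // mem_abres_commg // mem_morphim.
  have Dx := Dm x Gx; rewrite mem_morphpre ?groupX //.
  by rewrite morphX // mem_abres_exp // mem_morphim.
apply/abres_subP; split.
  move=> _ _ /morphimP[x Dx Gx ->] /morphimP[y Dy Gy ->].
  by rewrite -morphR // mem_morphim //; [apply: groupR | apply: mem_abres_commg].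
move=> _ /morphimP[x Dx Gx ->].
by rewrite -morphX // mem_morphim //; [apply: groupX | apply: mem_abres_exp].
Qed.

Lemma quotient_abres m (gT : finGroupType) (G K : {group gT}) :
  G \subset 'N(K) -> abres m G / K = abres m (G / K).
Proof. exact: morphim_abres. Qed.

Section PNilpotent.

Variable p : nat.

(** p-nilpotency: the p'-core is a normal p-complement. *)
Definition pnil (gT : finGroupType) (G : {set gT}) :=
  p^'.-Hall(G) 'O_p^'(G).

Variable gT : finGroupType.
Implicit Types G H K : {group gT}.

Lemma pnilP G : reflect (exists2 K : {group gT}, K <| G & p^'.-Hall(G) K) (pnil G).
Proof.
apply: (iffP idP) => [hG | [K nKG hK]].
  by exists 'O_p^'(G)%G; rewrite ?pcore_normal.
by rewrite /pnil (normal_Hall_pcore hK nKG).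
Qed.

Lemma pnilS G H : H \subset G -> pnil G -> pnil H.
Proof.
move=> sHG /pnilP[K nKG hK]; apply/pnilP; exists (K :&: H)%G.
  by rewrite /= setIC; apply: normalGI nKG.
exact: setI_normal_Hall hK sHG.
Qed.

Lemma pnil_p'group G : p^'.-group G -> pnil G.
Proof. by move=> p'G; rewrite /pnil pcore_pgroup_id // /pHall subxx p'G indexgg. Qed.

Lemma mem_pnil_core G x : pnil G -> x \in G -> p^'.-elt x -> x \in 'O_p^'(G).
Proof. by move=> hG Gx p'x; rewrite (mem_normal_Hall hG) ?pcore_normal. Qed.

Lemma pnil_extp'_normal G K :
  K <| G -> p^'.-group K -> pnil (G / K) -> pnil G.
Proof.
move=> nKG p'K; rewrite /pnil pquotient_pcore // pquotient_pHall //.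
by rewrite /normal pcore_max // (subset_trans (pcore_sub _ _)) // normal_norm.
Qed.

(** The p'-core of [G / K] lifts to [U], which Schur-Zassenhaus splits as [K W]. As the p'-group [W]
    centralises [K], it is the p'-core of [U], hence normal in [G]. *)
Lemma pnil_extp_normal G K : K <| G -> p.-group K -> pnil (G / K) ->
  {in G, forall x, p^'.-elt x -> x \in 'C(K)} -> pnil G.
Proof.
move=> nKG pK hGK cK; have [sKG nKG'] := andP nKG.
have [U defU sKU sUG] := inv_quotientN nKG (pcore_normal p^' (G / K)).
have nKU : K <| U by apply: normalS sKU _ nKG; apply: normal_sub sUG.
have p'UK : p^'.-group (U / K) by rewrite -defU pcore_pgroup.
have hK : Hall U K.
  rewrite /Hall sKU -card_quotient ?normal_norm //.
  exact: pnat_coprime pK p'UK.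
have /splitsP[W /complP[tiKW defW]] := SchurZassenhaus_split hK nKU.
have sWU : W \subset U by rewrite -defW mulG_subr.
have sWG : W \subset G := subset_trans sWU (normal_sub sUG).
have p'W : p^'.-group W.
  have /isog_pgroup-> : W \isog W / K.
    apply: quotient_isog; last exact: tiKW.
    exact: subset_trans sWU (normal_norm nKU).
  by rewrite (pgroupS _ p'UK) ?quotientS.
have cKW : W \subset 'C(K).
  by apply/subsetP=> x Wx; apply: cK (mem_p_elt p'W Wx); apply: subsetP Wx.
have [_ hW] := coprime_mulpG_Hall defW pK p'W.
have nWU : W <| U.
  rewrite /normal sWU -defW mul_subG ?normG //.
  by rewrite cents_norm // centsC.
apply/pnilP; exists W.
  rewrite -(normal_Hall_pcore hW nWU) gFnormal_trans //.
have cW : #|G| = (#|K| * #|G / K|)%N.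
  by rewrite card_quotient // Lagrange.
rewrite pHallE sWG cW partnM ?cardG_gt0 //= part_p'nat ?pnatNK // mul1n.
rewrite -(card_Hall hGK) defU; apply/eqP.
rewrite -defW quotientMidl card_quotient ?(subset_trans cKW (cent_sub K)) //.
by rewrite -divgI /= setIC tiKW cards1 divn1.
Qed.

End PNilpotent.

Lemma morphim_pnil p (aT rT : finGroupType) (D : {group aT})
    (f : {morphism D >-> rT}) (G : {group aT}) :
  G \subset D -> pnil p G -> pnil p (f @* G).
Proof.
move=> sGD /pnilP[K nKG hK]; apply/pnilP; exists (f @* K)%G.
  exact: morphim_normal.
by apply: morphim_pHall hK; apply: subset_trans (normal_sub nKG) sGD.
Qed.

Lemma isog_pnil p (aT rT : finGroupType) (G : {group aT}) (H : {group rT}) :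
  G \isog H -> pnil p G -> pnil p H.
Proof. by case/isogP=> f _ <-; apply: morphim_pnil. Qed.

Lemma quotient_pnil p (gT : finGroupType) (G K : {group gT}) :
  G \subset 'N(K) -> pnil p G -> pnil p (G / K).
Proof. exact: morphim_pnil. Qed.

(** [K] need not lie in [G], which allows [G] to be a verbal subgroup and [K] a normal subgroup of
    the ambient group. *)
Lemma pnil_extp' (p : nat) (gT : finGroupType) (G K : {group gT}) :
  G \subset 'N(K) -> p^'.-group K -> pnil p (G / K) -> pnil p G.
Proof.
move=> nKG p'K hGK; apply: (@pnil_extp'_normal _ _ G (K :&: G)%G) => /=.
- by rewrite /normal subsetIr normsI ?normG.
- by apply: pgroupS p'K; apply: subsetIl.
- by apply: isog_pnil hGK; rewrite isog_sym; apply: second_isog.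
Qed.

Lemma pnil_extp (p : nat) (gT : finGroupType) (G K : {group gT}) :
  G \subset 'N(K) -> p.-group K -> pnil p (G / K) ->
  {in G, forall x, p^'.-elt x -> x \in 'C(K)} -> pnil p G.
Proof.
move=> nKG pK hGK cK; apply: (@pnil_extp_normal _ _ G (K :&: G)%G) => /=.
- by rewrite /normal subsetIr normsI ?normG.
- by apply: pgroupS pK; apply: subsetIl.
- by apply: isog_pnil hGK; rewrite isog_sym; apply: second_isog.
- by move=> x Gx /(cK x Gx); apply: subsetP; apply: centS; apply: subsetIl.
Qed.

(** * Formations and the canonical local satellite *)

Section Formation.

Variable F : group_class.
Hypotheses (formF : formation F) (F1 : forall gT : finGroupType, F _ [1 gT]%G).

Variable gT : finGroupType.
Implicit Types G K N : {group gT}.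

Lemma formation_morphim_residual (rT : finGroupType) G
    (f : {morphism G / residual F G >-> rT}) :
  F _ (f @* (G / residual F G))%G.
Proof. by case: formF => [/(_ _ [1 gT]%G)/(_ (F1 gT)) // | [_]]; apply. Qed.

Lemma residual_normal G : residual F G <| G.
Proof.
have : residual F G \subset G.
  apply: (bigcap_min G) => //; rewrite normal_refl /=; apply/asboolP.
  by rewrite (_ : (G / G)%G = 1%G) //; apply/val_inj/trivg_quotient.
rewrite /normal => -> /=; apply/norms_bigcap/bigcapsP => N /andP[/andP[_ nNG] _].
exact: nNG.
Qed.

Lemma residual_sub_normal G N : N <| G -> F _ (G / N)%G -> residual F G \subset N.
Proof. by move=> nNG FN; apply: (bigcap_min N); rewrite // nNG; apply/asboolP. Qed.

Lemma residual_trivg G : F _ G -> residual F G = 1%G.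
Proof.
move=> FG; apply/trivGP; apply: residual_sub_normal; first exact: normal1.
apply: in_class_isog FG; apply: quotient1_isog.
Qed.

(** [G / K] is the image of [G / residual F G] under the natural map, the kind of image that the
    formation axiom speaks of. *)
Lemma formation_quotient_residual G K :
  residual F G \subset K -> K <| G -> F _ (G / K)%G.
Proof.
move=> sRK /andP[sKG nKG]; set R := residual F G in sRK *.
have sKK : 'ker (coset R) \subset 'ker (restrm nKG (coset K)).
  rewrite ker_restrm !ker_coset subsetI sRK andbT.
  exact: subset_trans sRK sKG.
have nRG : G \subset 'N(R) by apply/normal_norm/residual_normal.
pose h := factm_morphism sKK nRG.
have := formation_morphim_residual h.
apply: in_class_isog.
suff -> : (h @* (G / R))%G = (G / K)%G by apply: isog_refl.
by apply: val_inj; rewrite /= morphim_factm morphim_restrm setIid.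
Qed.

Lemma formation_quotient_self G : F _ (G / residual F G)%G.
Proof. by apply: formation_quotient_residual; rewrite ?residual_normal. Qed.

Lemma formation_quotient G K : F _ G -> K <| G -> F _ (G / K)%G.
Proof.
by move=> FG; apply: formation_quotient_residual; rewrite residual_trivg ?sub1G.
Qed.

End Formation.

(** * Coprime action, the wreath product and supersoluble groups *)

Section Coprime.

Variables (gT : finGroupType) (p : nat).
Implicit Types A G H K M N Q : {group gT}.

(** [A] centralises [M / N], and by coprimeness ['C_M(A)] maps onto the fixed points of [A] in
    [M / N]. *)
Lemma coprime_comm_cent_mulG A M N :
  A \subset 'N(M) -> A \subset 'N(N) -> N \subset M -> coprime #|M| #|A| ->
  solvable M -> M \subset 'N(N) -> [~: M, A] \subset N -> N * 'C_M(A) = M.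
Proof.
move=> nMA nNA sNM coMA solM nNM sRN.
have sCM : 'C_M(A) \subset M by apply: subsetIl.
apply/eqP; rewrite eqEsubset mul_subG //= -quotientSK //.
rewrite coprime_quotient_cent // subsetI subxx /=.
by rewrite quotient_cents2 // commGC commGC.
Qed.

(** Lifting fixed points gives [M = N * 'C_M(A)], and [A] centralises both factors. *)
Lemma coprime_stable_cent A M N :
  A \subset 'N(M) -> A \subset 'N(N) -> N \subset M -> coprime #|M| #|A| ->
  solvable M -> M \subset 'N(N) -> [~: M, A] \subset N -> A \subset 'C(N) ->
  A \subset 'C(M).
Proof.
move=> nMA nNA sNM coMA solM nNM sRN cNA.
rewrite -(coprime_comm_cent_mulG nMA nNA sNM coMA solM nNM sRN).
by rewrite centM subsetI cNA centsC subsetIr.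
Qed.

(** ['C_M(A)] supplements the Frattini subgroup, so it is all of [M]. *)
Lemma coprime_Phi_cent A M :
  p.-group M -> p^'.-group A -> A \subset 'N(M) -> [~: M, A] \subset 'Phi(M) ->
  A \subset 'C(M).
Proof.
move=> pM p'A nMA sRPhi.
have nPhi : A \subset 'N('Phi(M)) by apply: gFnorm_trans.
have := coprime_comm_cent_mulG nMA nPhi (Phi_sub M) (pnat_coprime pM p'A)
  (pgroup_sol pM) (gFnorm _ M) sRPhi.
rewrite -norm_joinEr; last by rewrite subIset ?gFnorm.
by move/Phi_nongen; rewrite genGid => /setIidPl; rewrite centsC.
Qed.

(** [G] acts on [Q] through [Aut Q], which is abelian of order [#|Q|.-1]. *)
Lemma abres_cent_prime G Q :
  prime #|Q| -> G \subset 'N(Q) -> abres #|Q|.-1 G \subset 'C(Q).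
Proof.
move=> prQ nQG; have cycQ := prime_cyclic prQ.
have cardA : #|Aut Q| = #|Q|.-1 by rewrite card_Aut_cyclic // totient_prime.
have kerC x : x \in G -> conj_aut Q x = 1 -> x \in 'C(Q).
  move=> Gx c1; have : x \in 'ker_G (conj_aut Q).
    by rewrite inE Gx; apply/kerP; rewrite ?(subsetP nQG).
  by rewrite ker_conj_aut // inE => /andP[].
have NQ x : x \in G -> x \in 'N(Q) by apply: subsetP.
have AQ x : conj_aut Q x \in Aut Q by apply: Aut_aut.
apply/abres_subP; split=> [x y Gx Gy | x Gx].
  apply: kerC; rewrite ?groupR // morphR ?NQ //.
  by apply/eqP/commgP/(centsP (Aut_cyclic_abelian cycQ)); apply: AQ.
apply: kerC; rewrite ?groupX // morphX ?NQ //.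
by rewrite -cardA; apply/expg_cardG/AQ.
Qed.

End Coprime.

Section Wreath.

Variables (gT : finGroupType) (p : nat) (X : {group gT}).
Hypothesis pr_p : prime p.

(* The witness is the regular wreath product of a group of order p by X. *)
Lemma regular_wreath_exists :
  exists (wT : finGroupType) (B W : {group wT}),
    [/\ B <| W, p.-abelem B, 'C_W(B) \subset B & W / B \isog X].
Proof.
pose rG := regular_repr 'F_p X; pose to := ('MR rG)%gact.
pose B := (sdpair1 to @* [set: 'rV['F_p]_#|X|])%G; pose K := (sdpair2 to @* X)%G.
have defW : B ><| K = [set: sdprod_by to] := sdprod_sdpair to.
have [nBW sKW mulBK nBK tiBK] := sdprod_context defW.
have abB : p.-abelem B by rewrite morphim_abelem // mx_Fp_abelem.
exists (sdprod_by to), B, [set: sdprod_by to]%G; split=> //.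
  apply/subsetP=> w /setIP[Ww cBw]; move: Ww; rewrite -mulBK.
  case/mulsgP=> b k Bb Kk defw; rewrite defw groupMl //.
  have cBk : k \in 'C(B).
    rewrite (canRL (mulKg b) (esym defw)) groupM ?groupV //.
    exact: (subsetP (abelem_abelian abB)).
  case/morphimP: Kk cBk => x Dx Xx -> cBx.
  (* An element of [X] centralising [B] fixes every vector, and the regular representation is
     faithful. *)
  have : x \in 'C([set: 'rV['F_p]_#|X|] | to).
    by rewrite (astabEsd to (subxx _)) mem_morphpre.
  move=> fix_x; have : x \in rker rG.
    apply/rkerP; split=> //; apply/row_matrixP=> i; rewrite rowE.
    pose e : 'rV['F_p]_#|X| := delta_mx 0%R i.
    have := astab_act fix_x (in_setT e); rewrite /= mx_repr_actE // => ->.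
    by rewrite rowE mulmx1.
  by move/(subsetP (regular_mx_faithful _ _))/set1P->; rewrite morph1 group1.
rewrite isog_sym; apply: isog_trans (sdprod_isog defW).
by apply: sub_isog; rewrite ?injm_sdpair2.
Qed.

End Wreath.

(** Intersecting a cyclic normal series of [W] with [B] gives factors of order 1 or [p]. The verbal
    subgroup for [p.-1] acts trivially on each, and a p'-element stabilising a series of a p-group
    centralises the group. *)
Lemma supersoluble_abres_cent (gT : finGroupType) (p : nat) (W B : {group gT}) x :
  prime p -> supersoluble W -> B <| W -> p.-abelem B ->
  x \in abres p.-1 W -> p^'.-elt x -> x \in 'C(B).
Proof.
move=> pr_p [s sP defW] nBW abB Vx p'x; have [sBW nBW'] := andP nBW.
have Wx : x \in W by apply: subsetP Vx; apply: abres_sub.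
suff: x \in 'C(B :&: last 1%G s) by rewrite defW (setIidPl sBW).
have: x \in 'C(B :&: 1%G) by rewrite setIC setI1g cent1T inE.
have: 1%G <| W by apply: normal1.
elim: s 1%G sP {defW} => //= H s IHs K /andP[/and3P[sKH nHW cycHK] sP] nKW cKx.
apply: IHs => //; set M := B :&: H; set N := B :&: K in cKx.
have nMW : M <| W by apply: normalI.
have nNW : N <| W by apply: normalI.
have sNM : N \subset M by apply: setIS.
have sMW := normal_sub nMW; have nNW' := normal_norm nNW.
have nNM : M \subset 'N(N) := subset_trans sMW nNW'.
have pM : p.-group M by apply: pgroupS (abelem_pgroup abB); apply: subsetIl.
have cycMN : cyclic (M / N).
  have nKM : M \subset 'N(K) := subset_trans sMW (normal_norm nKW).
  have -> : N = K :&: M by rewrite setIC /M -setIA (setIidPr sKH).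
  rewrite (isog_cyclic (second_isog nKM)).
  by apply: cyclicS cycHK; apply: quotientS; apply: subsetIr.
have abMN : p.-abelem (M / N).
  by apply: quotient_abelem; apply: abelemS abB; apply: subsetIl.
have cMNV : abres p.-1 W / N \subset 'C(M / N).
  rewrite quotient_abres //; case: (eqVneq (M / N) 1) => [-> | ntMN].
    by rewrite cents1.
  have oMN : #|M / N| = p by apply: cyclic_abelem_prime.
  rewrite -{1}oMN; apply: abres_cent_prime; first by rewrite oMN.
  by rewrite quotient_norms ?normal_norm.
have sxV : <[x]> \subset abres p.-1 W by rewrite cycle_subG.
have sxW : <[x]> \subset W by rewrite cycle_subG.
rewrite -cycle_subG; apply: (@coprime_stable_cent _ _ [group of M] [group of N]) => //=.
- exact: subset_trans sxW (normal_norm nMW).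
- exact: subset_trans sxW nNW'.
- by apply: pnat_coprime pM _; rewrite -orderE.
- exact: pgroup_sol pM.
- rewrite -quotient_cents2 //; last exact: subset_trans sxW nNW'.
  by rewrite centsC (subset_trans _ cMNV) ?quotientS.
- by rewrite cycle_subG.
Qed.

Lemma isog_abres m (aT rT : finGroupType) (G : {group aT}) (H : {group rT}) :
  G \isog H -> abres m G \isog abres m H.
Proof.
case/isogP=> f injf <-; rewrite -morphim_abres //.
by apply: sub_isog injf; apply: abres_sub.
Qed.

Lemma supersoluble_sol (gT : finGroupType) (G : {group gT}) :
  supersoluble G -> solvable G.
Proof.
case=> s sP <-; have : solvable (1%G : {group gT}) by apply: solvable1.
have : 1%G <| G by apply: normal1.
elim: s 1%G sP => //= H s IHs K /andP[/and3P[sKH nHG cycHK] sP] nKG solK.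
apply: IHs => //; rewrite (series_sol (normalS sKH (normal_sub nHG) nKG)) solK.
exact: abelian_sol (cyclic_abelian cycHK).
Qed.

(** * Abelian groups in a formation *)

Section AbelianFormation.

Variables (F : group_class).
Hypotheses (formF : formation F) (F1 : forall gT : finGroupType, F _ [1 gT]%G).

Lemma formation_subdirect (gT : finGroupType) (G M N : {group gT}) :
  M <| G -> N <| G -> M :&: N = 1 -> F _ (G / M)%G -> F _ (G / N)%G -> F _ G.
Proof.
move=> nMG nNG tiMN FM FN.
have sR1 : residual F G \subset 1%G.
  by rewrite /= -tiMN subsetI !residual_sub_normal.
have := formation_quotient_residual formF F1 sR1 (normal1 G).
by apply: in_class_isog; rewrite isog_sym; apply: quotient1_isog.
Qed.

Lemma formation_complement (gT : finGroupType) (G H K : {group gT}) :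
  abelian G -> H :&: K = 1 -> H * K = G -> (F _ (G / K)%G <-> F _ H).
Proof.
move=> abG tiHK mulHK; have sHG : H \subset G by rewrite -mulHK mulG_subl.
have sKG : K \subset G by rewrite -mulHK mulG_subr.
have iso : H \isog G / K.
  rewrite -mulHK quotientMidr; apply: quotient_isog; last by rewrite setIC.
  exact: subset_trans sHG (sub_abelian_norm abG sKG).
by split; apply: in_class_isog; rewrite // isog_sym.
Qed.

(** A cycle of order the exponent is a direct factor of an abelian group, hence isomorphic to a
    quotient. *)
Lemma formation_cycle (gT : finGroupType) (G : {group gT}) z :
  abelian G -> z \in G -> #[z] = exponent G -> F _ G -> F _ <[z]>%G.
Proof.
move=> abG Gz oz FG; have /splitsP[K /complP[tiK mulK]] := abelian_splits Gz oz abG.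
apply/(formation_complement abG tiK mulK); apply: formation_quotient => //.
by rewrite -sub_abelian_normal // -mulK mulG_subr.
Qed.

Lemma formation_setX (aT bT : finGroupType) (A : {group aT}) (B : {group bT}) :
  F _ A -> F _ B -> F _ (setX A B)%G.
Proof.
move=> FA FB; pose f1 := [morphism of fun x : aT * bT => x.1].
pose f2 := [morphism of fun x : aT * bT => x.2]; set G := (setX A B)%G.
have sGT1 : G \subset setT := subsetT _.
have iso1 : G / 'ker_G f1 \isog A.
  by rewrite -[gval A](morphim_fstX A B); apply: first_isog_loc.
have iso2 : G / 'ker_G f2 \isog B.
  by rewrite -[gval B](morphim_sndX A B); apply: first_isog_loc.
have nK1 : 'ker_G f1 <| G by rewrite -(ker_restrm sGT1 f1) ker_normal.
have nK2 : 'ker_G f2 <| G by rewrite -(ker_restrm sGT1 f2) ker_normal.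
apply: (formation_subdirect nK1 nK2).
- apply/trivgP/subsetP=> x /setIP[/setIP[_ K1x] /setIP[_ K2x]].
  move: (mker K1x) (mker K2x) => /= x1 x2.
  by case: x x1 x2 {K1x K2x} => a b /= -> ->; apply/set1gP.
- by move: FA; apply: in_class_isog; rewrite isog_sym.
- by move: FB; apply: in_class_isog; rewrite isog_sym.
Qed.

(** A cyclic group has a quotient of each order dividing its own, and cyclic groups of equal order
    are isomorphic. *)
Lemma formation_cyclic_dvd (aT bT : finGroupType)
    (A : {group aT}) (B : {group bT}) :
  cyclic A -> cyclic B -> #|B| %| #|A| -> F _ A -> F _ B.
Proof.
case/cyclicP=> a defA cycB dvdBA FA; pose K := <[a ^+ #|B|]>%G.
have oa : #[a] = #|A| by rewrite orderE defA.
have sKA : K \subset A by rewrite /= defA cycleX.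
have nKA : K <| A by rewrite -sub_abelian_normal // defA cycle_abelian.
have oAK : #|A / K| = #|B|.
  rewrite card_quotient ?normal_norm // -divgS // -orderE orderXdiv oa //.
  by rewrite divnA // mulKn.
have := formation_quotient formF F1 FA nKA; apply: in_class_isog.
rewrite isog_cyclic_card /= ?cycB ?oAK ?eqxx //.
by rewrite quotient_cyclic // defA cycle_cyclic.
Qed.

(** Split off a cycle [<[y]>] of order the exponent of [G], with complement [K]: the cycle is an
    image of [Z], induction handles [K], and [G] is a subdirect product of the two. *)
Lemma formation_abelian m (C : finGroupType) (Z : {group C}) :
  cyclic Z -> #|Z| = m -> F _ Z ->
  forall (gT : finGroupType) (G : {group gT}),
    abelian G -> exponent G %| m -> F _ G.
Proof.
move=> cycZ oZ FZ gT G; have [n] := ubnP #|G|.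
elim: n gT G => // n IHn gT G /ltnSE-leGn abG expG.
have [G1 | ntG] := eqVneq (gval G) 1.
  by rewrite (_ : G = 1%G) //; apply: val_inj.
have [y Gy oy] := exponent_witness (abelian_nil abG).
have /splitsP[K /complP[tiK mulK]] := abelian_splits Gy (esym oy) abG.
have sKG : K \subset G by rewrite -mulK mulG_subr.
have syG : <[y]> \subset G by rewrite cycle_subG.
have nt_y : 1 < #[y].
  rewrite -oy ltn_neqAle eq_sym exponent_gt0 andbT.
  by rewrite -dvdn1 -trivg_exponent ntG.
have Fy : F _ <[y]>%G.
  apply: formation_cyclic_dvd cycZ (cycle_cyclic y) _ FZ.
  by rewrite oZ -[#|_|]/#[y] -oy.
have FK : F _ K.
  apply: IHn; last 2 first.
  - exact: abelianS abG.
  - exact: dvdn_trans (exponentS sKG) expG.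
  rewrite (leq_trans _ leGn) // -mulK TI_cardMg //.
  by rewrite -[X in X < _]mul1n ltn_pmul2r ?cardG_gt0.
apply: (@formation_subdirect _ G K <[y]>%G).
- by rewrite -sub_abelian_normal.
- by rewrite -sub_abelian_normal.
- by rewrite setIC.
- exact/(formation_complement abG tiK mulK).
- apply/(@formation_complement _ G K <[y]>%G) => //; first by rewrite setIC.
  by rewrite -mulK (centC (centSS syG sKG abG)).
Qed.

End AbelianFormation.

(** [Z/d] for [d > 0]. Writing the order as [d.-1.+1] makes the type a group; [d = 0] gives the
    trivial group. *)
Definition cyclic_model (d : nat) : {group 'I_d.-1.+1} := [set: 'I_d.-1.+1]%G.

Lemma card_cyclic_model d : 0 < d -> #|cyclic_model d| = d.
Proof. by move=> d_gt0; rewrite cardsT card_ord prednK. Qed.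

Lemma cyclic_model_cyclic d : cyclic (cyclic_model d).
Proof. by apply/cyclicP; exists Zp1; apply: Zp_cycle. Qed.

(** * The values of the canonical local satellite *)

Section Satellite.

Variables (F : group_class) (f : nat -> group_class).
Hypotheses (formF : formation F) (nilF : sub_class nilpotent_groups F).
Hypotheses (superF : sub_class F supersoluble) (canF : canonical_satellite F f).

Lemma nilpotent_formation_trivg (gT : finGroupType) : F _ [1 gT]%G.
Proof. by apply: nilF; apply: nilpotent1. Qed.

(** The group of order [p] is nilpotent, hence in [F], and its chief factor puts some group in
    [f p]. So [f p] is not empty, and [pgroup_by] then supplies the trivial groups. *)
Lemma satellite_trivg p (gT : finGroupType) : prime p -> f p _ [1 gT]%G.
Proof.
move=> pr_p; have [_ LFf fE _] := canF.
have p_gt0 := prime_gt0 pr_p; set Z := cyclic_model p.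
have oZ : #|Z| = p by rewrite card_cyclic_model.
have ntZ : Z :!=: 1 by rewrite trivg_card1 oZ neq_ltn prime_gt1 ?orbT.
have prZ : prime #|Z| by rewrite oZ.
have abZ : abelian Z by rewrite cyclic_abelian ?prime_cyclic.
have FZ : F _ Z by apply: nilF; apply: abelian_nil.
have chZ : chief_factor Z 1 Z.
  rewrite /chief_factor normal_refl andbT; apply/maxgroupP; split.
    by rewrite proper1G ntZ norms1.
  move=> H /andP[/andP[sHZ nsZH] nHZ] _; apply/trivgP.
  by rewrite -(prime_TIg prZ nsZH) subsetI sHZ subxx.
have := LFf _ Z; case=> /(_ FZ) [Z1 | [_ /(_ Z 1%G chZ p pr_p)]].
  by case/eqP: ntZ.
have -> : p %| #|Z / 1|.
  by rewrite -(card_isog (quotient1_isog Z)) oZ.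
move=> /(_ isT) /(fE p pr_p) [f1 _] _.
apply: in_class_isog f1; exact: trivial_isog.
Qed.

(** The extension [W] of [B] by [X] lies in [f p], hence is supersoluble. A p'-element of its verbal
    subgroup centralises [B], so it lies in the p-group [B] and is trivial. *)
Lemma satellite_sub_abres p (gT : finGroupType) (X : {group gT}) :
  prime p -> f p _ X -> p.-group (abres p.-1 X).
Proof.
move=> pr_p fX; have [formf _ fE sfF] := canF.
have f1 aT : f p _ [1 aT]%G by apply: satellite_trivg.
have [wT [B [W [nBW abB cBW isoX]]]] := regular_wreath_exists X pr_p.
have pB := abelem_pgroup abB.
have fW : f p _ W.
  apply/fE => //; split=> //; apply: pgroupS pB; apply: residual_sub_normal => //.
  by move: fX; apply: in_class_isog; rewrite isog_sym.
have sW := superF (sfF p pr_p _ _ fW).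
rewrite -(isog_pgroup p (isog_abres p.-1 isoX)) /= -quotient_abres ?normal_norm //.
rewrite quotient_pgroup //; apply/pgroupP=> q pr_q /Cauchy[] // x Vx ox.
apply: contraT => neq_qp; have p'x : p^'.-elt x.
  by rewrite /p_elt ox pnatE // !inE.
have cBx := supersoluble_abres_cent pr_p sW nBW abB Vx p'x.
have Bx : x \in B.
  rewrite (subsetP cBW) // inE cBx andbT.
  by apply: subsetP Vx; apply: abres_sub.
by have := pnat_1 (mem_p_elt pB Bx) p'x; rewrite ox => q1; rewrite q1 in pr_q.
Qed.

Lemma satellite_abresP p : prime p -> exists2 m, m %| p.-1 &
  forall (gT : finGroupType) (X : {group gT}),
    f p _ X <-> p.-group (abres m X).
Proof.
move=> pr_p; have [formf' _ fE _] := canF; have formf := formf' p pr_p.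
have f1 aT : f p _ [1 aT]%G by apply: satellite_trivg.
have p1_gt0 : 0 < p.-1 by rewrite -subn1 subn_gt0 prime_gt1.
(* [m] will be the largest divisor [d] of [p.-1] with [Z/d] in [f p]. *)
pose P d := (d %| p.-1) && `[< f p _ (cyclic_model d) >].
have exP : exists d, P d.
  exists 1%N; rewrite /P dvd1n; apply/asboolP.
  rewrite (_ : cyclic_model 1 = 1%G) //; apply: val_inj.
  by apply: card1_trivg; apply: card_cyclic_model.
have ubP d : P d -> d <= p.-1 by case/andP=> /dvdn_leq->.
have [m /andP[dvd_m /asboolP fm] max_m] := ex_maxnP exP ubP.
have m_gt0 : 0 < m by apply: dvdn_gt0 dvd_m.
have oZm : #|cyclic_model m| = m by apply: card_cyclic_model.
have cycZm : cyclic (cyclic_model m) by apply: cyclic_model_cyclic.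
exists m => // gT X; split=> [fX | pVX].
  have pV1X := satellite_sub_abres pr_p fX.
  set V1 := abres_group p.-1 X.
  have nV1X : V1 <| X by apply: abres_normal.
  have : abres p.-1 (X / V1) == 1.
    by rewrite -quotient_abres ?normal_norm // trivg_quotient.
  case/abres_trivP=> abY expY; set Y := (X / V1)%G in abY expY.
  have fY : f p _ Y by apply: formation_quotient.
  have dvd_em : exponent Y %| m.
    (* An element [z] of order the exponent of the product of [Y] and [Z/m] has order a multiple of
       [m] dividing [p.-1], and [<[z]>] is in [f p]; maximality of [m] makes this order equal to
       [m]. *)
    pose G := (setX Y (cyclic_model m))%G.
    have fG : f p _ G by apply: formation_setX.
    have exp_pair (u : coset_of V1 * 'I_m.-1.+1) k : u ^+ k = (u.1 ^+ k, u.2 ^+ k).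
      by elim: k => // k IHk; rewrite !expgS IHk.
    have abG : abelian G.
      apply/centsP=> -[a b] /setXP[/= Ya Zb] [c d] /setXP[/= Yc Zd].
      by congr (_, _); [apply: (centsP abY) | apply: (centsP (cyclic_abelian cycZm))].
    have [z Gz oz] := exponent_witness (abelian_nil abG).
    have fz : f p _ <[z]>%G by apply: formation_cycle fG.
    have dvd_z : #[z] %| p.-1.
      case: (z) (Gz) => a b /setXP[/= Ya Zb]; rewrite order_dvdn.
      have e1 : a ^+ p.-1 = 1 by apply: expY.
      have e2 : b ^+ p.-1 = 1.
        apply/eqP; rewrite -order_dvdn (dvdn_trans _ dvd_m) //.
        by have := order_dvdG Zb; rewrite oZm.
      by rewrite exp_pair e1 e2.
    have z_gt0 : 0 < #[z] by apply: order_gt0.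
    have Pz : P #[z].
      rewrite /P dvd_z; apply/asboolP; apply: in_class_isog fz.
      rewrite isog_cyclic_card ?cycle_cyclic //= cyclic_model_cyclic.
      by rewrite card_cyclic_model // -orderE eqxx.
    have dvd_mz : m %| #[z].
      have [b defZ] := cyclicP cycZm.
      have Gb : (1, b) \in G by rewrite in_setX /= group1 defZ cycle_id.
      have := expg_exponent Gb; rewrite oz exp_pair => -[_ /eqP].
      by rewrite -order_dvdn orderE -defZ oZm.
    have -> : m = #[z].
      by apply/eqP; rewrite eqn_leq max_m // dvdn_leq.
    rewrite -oz; apply/exponentP=> y Yy.
    have Gy : (y, 1) \in G by rewrite in_setX /= Yy group1.
    by have := expg_exponent Gy; rewrite exp_pair => -[].
  apply: pgroupS pV1X; apply/abres_subP; split=> [x y Xx Xy | x Xx].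
    exact: mem_abres_commg.
  have nx : x \in 'N(V1) by apply: subsetP (normal_norm nV1X) _ Xx.
  apply: coset_idr; first by rewrite groupX.
  by rewrite morphX //; apply: (exponentP dvd_em); apply: mem_quotient.
(* Conversely, the quotient by the verbal subgroup is abelian of exponent dividing [m], so it is in
   [f p] and the residual lies in that p-group. *)
apply/fE => //; split=> //; apply: pgroupS pVX.
have nVX : abres m X <| X by apply: abres_normal.
apply: residual_sub_normal => //.
apply: (formation_abelian formf f1 cycZm oZm fm).
  by apply: sub_der1_abelian; apply: der1_sub_abres.
apply/exponentP=> _ /morphimP[x nx Xx ->].
by rewrite -morphX //; apply: coset_id; apply: mem_abres_exp.
Qed.

End Satellite.

(** * The formation in terms of p-nilpotency *)

Lemma minnormal_chief_factor (gT : finGroupType) (G N : {group gT}) :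
  minnormal N G -> N \subset G -> chief_factor G 1 N.
Proof.
case/mingroupP=> /andP[ntN nNG] minN sNG; rewrite /chief_factor /normal sNG nNG !andbT.
apply/maxgroupP; rewrite proper1G ntN norms1; split=> // H /andP[prHN nHG] _.
apply/eqP; apply: contraTT prHN => ntH; rewrite /proper negb_and negbK.
by case: (boolP (H \subset N)) => //= sHN; rewrite (minN H) ?ntH.
Qed.

Lemma astabQ_cent (gT : finGroupType) (G H K : {group gT}) :
  G \subset 'N(K) -> H \subset 'N(K) ->
  (G \subset 'C(H / K | 'Q)) = ([~: G, H] \subset K).
Proof.
move=> nKG nKH; rewrite astabQ -sub_quotient_pre // -quotient_cents2 //.
Qed.

Lemma astabQ_normal (gT : finGroupType) (G H K : {group gT}) :
  G \subset 'N(H) -> G \subset 'N(K) -> 'C_G(H / K | 'Q) <| G.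
Proof.
move=> nHG nKG; rewrite /normal subsetIl normsI ?normG //= astabQ.
apply: subset_trans (morphpre_norm _ _); rewrite -sub_quotient_pre //.
by rewrite norms_cent ?quotient_norms.
Qed.

Lemma coprime_normal_cent (gT : finGroupType) (G H K : {group gT}) :
  H <| G -> K <| G -> coprime #|H| #|K| -> H \subset 'C(K).
Proof.
move=> /andP[sHG nHG] /andP[sKG nKG] coHK.
apply/commG1P/trivgP; rewrite -(coprime_TIg coHK) subsetI.
by rewrite commg_subl commg_subr (subset_trans sHG) // (subset_trans sKG).
Qed.

Section Characterisation.

Variables (F : group_class) (f : nat -> group_class) (m : nat -> nat).
Hypotheses (formF : formation F) (F1 : forall gT : finGroupType, F _ [1 gT]%G).
Hypotheses (solF : forall (gT : finGroupType) (G : {group gT}), F _ G -> solvable G).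
Hypotheses (LFf : eq_class F (LF f)).
Hypotheses (fE : forall p, prime p -> forall (gT : finGroupType) (X : {group gT}),
  f p _ X <-> p.-group (abres (m p) X)).

(** Induction through a minimal normal subgroup [N], an r-group. For [r != p] it is a p'-group below
    a p-nilpotent quotient. For [r = p] it is a chief factor on which the verbal subgroup acts as a
    p-group, so p'-elements of the latter centralise [N]. *)
Lemma formation_pnil (gT : finGroupType) (G : {group gT}) p :
  prime p -> F _ G -> pnil p (abres (m p) G).
Proof.
move=> pr_p; have [n] := ubnP #|G|.
elim: n gT G => // n IHn gT G /ltnSE-leGn FG; have solG := solF FG.
have [G1 | ntG] := eqVneq (gval G) 1.
  apply: pnil_p'group; apply: pgroupS (abres_sub _ _) _.
  by rewrite G1; apply: pgroup1.
have [N minN sNG] := minnormal_exists ntG (normG G).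
have [nNG ntN /is_abelemP[r pr_r abN]] := minnormal_solvable minN sNG solG.
have rN := abelem_pgroup abN; have nNG' : N <| G by apply/andP.
have nNV : abres (m p) G \subset 'N(N) := subset_trans (abres_sub _ _) nNG.
have hV : pnil p (abres (m p) G / N).
  rewrite quotient_abres //; apply: IHn; last exact: formation_quotient.
  by apply: leq_trans (ltn_quotient ntN sNG) leGn.
have [eq_rp | neq_rp] := eqVneq r p; last first.
  apply: (pnil_extp' nNV _ hV); apply: sub_in_pnat rN => q _ /eqnP->.
  by rewrite !inE.
rewrite {r}eq_rp in abN rN pr_r; apply: (pnil_extp nNV rN hV) => x Vx p'x.
have Gx : x \in G by apply: subsetP Vx; apply: abres_sub.
have chN := minnormal_chief_factor minN sNG.
have : F _ G by []. case/LFf=> [G1 | [_ /(_ N 1%G chN p pr_p)]].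
  by rewrite G1 eqxx in ntG.
have pN1 : p %| #|N / 1|.
  rewrite -(card_isog (quotient1_isog N)).
  by have [_ ->] := pgroup_pdiv rN ntN.
move=> /(_ pN1)/fE-/(_ pr_p) /=; set C := 'C_G(N / 1 | 'Q) => pVC.
have nC : C <| G.
  by apply: astabQ_normal; rewrite ?norms1.
have nCx : x \in 'N(C) by apply: subsetP (normal_norm nC) _ Gx.
have Cx : x \in C.
  apply: coset_idr => //; apply/eqP; rewrite -order_eq1.
  have V1x : coset C x \in abres (m p) (G / C).
    by rewrite -quotient_abres ?normal_norm // mem_quotient.
  by rewrite (pnat_1 (mem_p_elt pVC V1x)) //; apply: morph_p_elt.
case/setIP: Cx => _; rewrite -cycle_subG astabQ_cent ?norms1 //.
by move/trivgP/commG1P; rewrite cycle_subG.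
Qed.

(** By coprimeness the p'-core of the verbal subgroup centralises every chief factor of order
    divisible by [p], so the verbal subgroup acts on such a factor as a p-group. *)
Lemma pnil_formation (gT : finGroupType) (G : {group gT}) :
  solvable G -> (forall p, prime p -> pnil p (abres (m p) G)) -> F _ G.
Proof.
move=> solG hG; apply/LFf; have [G1 | ntG] := eqVneq (gval G) 1; first by left.
right; split=> // H K chHK p pr_p p_dvd; apply/fE => //=.
have [/maxgroupp/andP[/andP[sKH _] nKG] /andP[sHG nHG]] := andP chHK.
have nKH := subset_trans sHG nKG.
set C := 'C_G(H / K | 'Q); pose V := abres (m p) G; pose O := 'O_p^'(V).
have sVG : V \subset G := abres_sub _ _.
have sOV : O \subset V := pcore_sub _ _.
have sOG := subset_trans sOV sVG.
have nOG : O <| G by apply: gFnormal_trans (abres_normal _ _).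
have pHK : p.-group (H / K).
  have minHK := chief_factor_minnormal chHK.
  have [_ ntHK /is_abelemP[r pr_r abHK]] :=
    minnormal_solvable minHK (quotientS K sHG) (quotient_sol K solG).
  have rHK := abelem_pgroup abHK.
  by move: p_dvd => /(pgroupP rHK p pr_p)/eqnP->.
have sOC : O \subset C.
  rewrite subsetI sOG astabQ_cent ?(subset_trans sOG) //.
  rewrite -quotient_cents2 ?(subset_trans sOG) //.
  have pOK : p^'.-group (O / K) by rewrite quotient_pgroup ?pcore_pgroup.
  have nsHG : H <| G by apply/andP.
  apply: (@coprime_normal_cent _ (G / K)); rewrite ?quotient_normal //.
  by rewrite coprime_sym (pnat_coprime pHK).
have nCG : G \subset 'N(C) by apply: normal_norm; apply: astabQ_normal.
have hO : p^'.-Hall(V / C) (O / C).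
  apply: quotient_pHall; last exact: hG.
  exact: subset_trans sOG nCG.
rewrite -quotient_abres //; move/card_Hall: hO.
have /= -> : (O / C = 1)%g by apply: quotientS1.
rewrite cards1 => /esym/eqP; rewrite partn_eq1 ?cardG_gt0 //.
by rewrite pnatNK.
Qed.

End Characterisation.

Section PQuotient.

Variables (p : nat) (gT : finGroupType).
Implicit Types R C : {group gT}.

Lemma pgroup_quotient_p'elt R C x :
  p.-group (R / C) -> R \subset 'N(C) -> x \in R -> p^'.-elt x -> x \in C.
Proof.
move=> pRC nCR Rx p'x; have nCx := subsetP nCR x Rx.
apply: coset_idr => //; apply/eqP; rewrite -order_eq1.
have Rx' : coset C x \in R / C by rewrite mem_quotient.
by rewrite (pnat_1 (mem_p_elt pRC Rx')) //; apply: morph_p_elt.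
Qed.

Lemma p'elt_pgroup_quotient R C :
  R \subset 'N(C) -> {in R, forall x, p^'.-elt x -> x \in C} -> p.-group (R / C).
Proof.
move=> nCR cRC; apply/pgroupP=> q pr_q /Cauchy[] // _ /morphimP[x nCx Rx ->] ox.
have cx : coset C x.`_p^' = 1 by apply: coset_id; apply: cRC; rewrite ?p_elt_constt ?groupX.
have px : p.-elt (coset C x).
  by rewrite -p_eltNK; apply/constt1P; rewrite -[RHS]cx; apply/esym/morph_constt.
by move: px; rewrite /p_elt ox pnatE // => /eqnP->; apply: eqxx.
Qed.

End PQuotient.

(** * Heredity of the formation and F-subnormal overgroups *)

Section Hereditary.

Variables (F : group_class) (m : nat -> nat).
Hypotheses (formF : formation F) (F1 : forall gT : finGroupType, F _ [1 gT]%G).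
Hypothesis FP : forall (gT : finGroupType) (G : {group gT}),
  F _ G <-> solvable G /\ forall p, prime p -> pnil p (abres (m p) G).

Lemma formationS (gT : finGroupType) (G H : {group gT}) :
  H \subset G -> F _ G -> F _ H.
Proof.
move=> sHG /FP[solG hG]; apply/FP; split; first exact: solvableS solG.
by move=> p pr_p; apply: pnilS (hG p pr_p); apply: abresS.
Qed.

Lemma F_subnormal_trans (gT : finGroupType) (G H M : {group gT}) :
  F_subnormal F M H -> F_subnormal F G M -> F_subnormal F G H.
Proof.
move=> snHM snMG; elim: snHM => // {}H K maxHK FK _ snKG.
exact: F_subnormal_step maxHK FK snKG.
Qed.

(** Climb from [K] to a minimal overgroup [M] in [G]: then [K] is maximal in [M], and
    [M / gcore K M] is a quotient of [M / A], a subgroup of [G / A]. *)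
Lemma F_subnormal_over (gT : finGroupType) (G A K : {group gT}) :
  A <| G -> F _ (G / A)%G -> A \subset K -> K \subset G -> F_subnormal F G K.
Proof.
move=> nAG FGA; have [n] := ubnP (#|G| - #|K|).
elim: n K => // n IHn K /ltnSE-leGK sAK sKG.
have [-> | neKG] := eqVneq K G; first exact: F_subnormal_refl.
have prKG : K \proper G by rewrite properEneq neKG.
have exM : exists M : {group gT}, (K \proper M) && (M \subset G).
  by exists G; rewrite prKG subxx.
have [M minM] := ex_mingroup exM.
have [/andP[prKM sMG] uM] := mingroupP minM.
have maxKM : maximal K M.
  apply/maxgroupP; split=> // H prHM sKH.
  apply/eqP; rewrite eq_sym eqEproper sKH /=; apply/negP=> prKH.
  have sHM := proper_sub prHM; case/negP: (proper_subn prHM).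
  by rewrite (uM H) // prKH (subset_trans sHM).
apply: F_subnormal_step maxKM _ _; last first.
  apply: IHn => //; last exact: subset_trans sAK (proper_sub prKM).
  apply: leq_trans _ leGK; apply: ltn_sub2l; first exact: proper_card.
  exact: proper_card.
have nAM : A <| M.
  by apply: normalS sMG nAG; apply: subset_trans sAK (proper_sub prKM).
apply: formation_quotient_residual => //.
  apply: subset_trans (residual_sub_normal nAM _) _.
    by apply: formationS FGA; apply: quotientS.
  by apply: gcore_max => //; apply: normal_norm.
rewrite /normal gcore_norm andbT.
by apply: subset_trans (gcore_sub _ _) (proper_sub prKM).
Qed.

(** In the converse direction of the theorem it puts the product of the residual and an n-maximal
    subgroup in [F]. The verbal subgroup of [G] lies in [A] times that of [H], and both act on
    ['O_p(A)] as p-groups, so its p'-elements centralise ['O_p(A)]. *)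
Lemma formation_nilpotent_mul (gT : finGroupType) (G A H : {group gT}) :
  solvable G -> A <| G -> nilpotent A -> A * H = G -> F _ (G / A)%G ->
  (forall p, prime p -> p %| #|A| ->
    {in abres (m p) H, forall x, p^'.-elt x -> x \in 'C('O_p(A))}) ->
  F _ G.
Proof.
move=> solG nAG nilA mulAH FGA cH; apply/FP; split=> // p pr_p.
have [sAG nAG'] := andP nAG; have sHG : H \subset G by rewrite -mulAH mulG_subr.
set P := 'O_p(A); set Q := 'O_p^'(A).
have nPG : P <| G by apply: gFnormal_trans.
have nQG : Q <| G by apply: gFnormal_trans.
have nC : G \subset 'N('C(P)) by rewrite norms_cent ?normal_norm.
have [_ mulPQ cPQ _] := dprodP (nilpotent_pcoreC p nilA).
have pA : p.-group (A / 'C(P)).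
  rewrite -mulPQ quotientMl ?pgroupM; last first.
    by apply: subset_trans nC; apply: subset_trans sAG; apply: pcore_sub.
  by rewrite quotient_pgroup ?pcore_pgroup //= (quotientS1 cPQ) pgroup1.
have pH : p.-group (abres (m p) H / 'C(P)).
  apply: p'elt_pgroup_quotient.
    by apply: subset_trans nC; apply: subset_trans sHG; apply: abres_sub.
  have [p_dvd | ndvd] := boolP (p %| #|A|); first exact: cH.
  have P1 : P = 1.
    apply/eqP; apply: contraR ndvd => ntP.
    have [_ dvd _] := pgroup_pdiv (pcore_pgroup p A) ntP.
    by apply: dvdn_trans dvd (cardSg (pcore_sub _ _)).
  by move=> x _ _; rewrite /= -/P P1 -sub1set cents1.
have nAVH : abres (m p) H \subset 'N(A).
  by apply: subset_trans nAG'; apply: subset_trans sHG; apply: abres_sub.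
have defAV := norm_joinEr nAVH.
have sV : abres (m p) G \subset A <*> abres (m p) H.
  rewrite defAV.
  rewrite -quotientSK ?(subset_trans (abres_sub _ _)) //.
  rewrite !quotient_abres //; last exact: subset_trans sHG nAG'.
  by apply: abresS; rewrite -mulAH quotientMidl.
have pV : {in abres (m p) G, forall x, p^'.-elt x -> x \in 'C(P)}.
  move=> x Vx p'x; apply: (@pgroup_quotient_p'elt p _ (abres_group (m p) G)) => //=.
    apply: (@pgroupS _ _ [group of (A <*> abres (m p) H) / 'C(P)]).
      exact: quotientS.
    by rewrite /= defAV quotientMl ?pgroupM ?pA ?pH //; apply: subset_trans sAG nC.
  by apply: subset_trans nC; apply: abres_sub.
have nQV : abres (m p) G \subset 'N(Q).
  by apply: subset_trans (normal_norm nQG); apply: abres_sub.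
(* Remove the p'-group [Q] first; then [A / Q] is a p-group and the quotient by it is in [F]. *)
apply: (@pnil_extp' p _ _ [group of Q]) => //=; first exact: pcore_pgroup.
rewrite quotient_abres ?normal_norm //=.
have sQA : Q \subset A := pcore_sub _ _.
have nAQ : A / Q <| G / Q by apply: quotient_normal.
have pAQ : p.-group (A / Q).
  rewrite -mulPQ quotientMidr quotient_pgroup ?pcore_pgroup //.
apply: (@pnil_extp p _ _ (A / Q)%G) => //=.
- exact: subset_trans (abres_sub _ _) (normal_norm nAQ).
- rewrite quotient_abres ?normal_norm //.
  have FGQ : F _ (G / Q / (A / Q))%G.
    by apply: in_class_isog FGA; rewrite isog_sym; apply: third_isog.
  by have [_ /(_ p pr_p)] := (FP (G / Q / (A / Q))%G).1 FGQ.
- rewrite -quotient_abres ?normal_norm // => _ /morphimP[y nQy Vy ->] p'y.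
  (* The p'-part of the preimage [y] has the same coset as [y], and it is a p'-element. *)
  have eqy : coset Q y.`_p^' = coset Q y.
    by rewrite -[RHS](constt_p_elt p'y); apply: morph_constt.
  suff: coset Q y.`_p^' \in 'C(A / Q) by rewrite eqy.
  rewrite -mulPQ quotientMidr.
  have cPy : y.`_p^' \in 'C(P) by apply: pV; rewrite ?p_elt_constt ?groupX.
  apply: (subsetP (morphim_cent _ _)).
  by apply: mem_morphim => //; apply: groupX.
Qed.

End Hereditary.

(** * Maximal chains and F-subnormality *)

Section Deep.

Variable gT : finGroupType.
Implicit Types G H K M : {group gT}.

Lemma n_maximal_sub n H G : n_maximal n H G -> H \subset G.
Proof.
elim: n H => [H -> // | n IHn H [M nM /maxgroupp/proper_sub sHM]].
exact: subset_trans sHM (IHn M nM).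
Qed.

(** Containment in a k-maximal subgroup, rather than being one, passes to subgroups and follows from
    any chain of [k] proper inclusions below [G]. *)
Definition deep k H G := exists2 K, n_maximal k K G & H \subset K.

Lemma deep0 H G : H \subset G -> deep 0 H G.
Proof. by exists G. Qed.

Lemma deep_sub k H M G : H \subset M -> deep k M G -> deep k H G.
Proof. by move=> sHM [K nK sMK]; exists K => //; apply: subset_trans sMK. Qed.

Lemma deep_proper k H M G : H \proper M -> deep k M G -> deep k.+1 H G.
Proof.
move=> prHM [K nK sMK].
have prHK := proper_sub_trans prHM sMK.
have [eqHK | [L maxL sHL]] := maximal_exists (proper_sub prHK).
  by rewrite eqHK properxx in prHK.
by exists L => //; exists K.
Qed.

Lemma deep_leq j k H G : j <= k -> deep k H G -> deep j H G.
Proof.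
move/subnK <-; elim: (k - j) => // i IHi [K [M nM /maxgroupp/proper_sub sKM] sHK].
by apply: IHi; exists M => //; apply: subset_trans sKM.
Qed.

(** Each prime divisor [q] of [#|M|] that [H] lacks pays for one strict inclusion: [H] lies in a
    Hall q'-subgroup of [M], which is proper and loses no other prime. *)
Lemma deep_primes k H M G : solvable M -> H \subset M -> deep k M G ->
  deep (k + (size (primes #|M|) - size (primes #|H|))) H G.
Proof.
have [n] := ubnP #|M|; elim: n M k => // n IHn M k /ltnSE-leMn solM sHM dM.
have sub_pr : {subset primes #|H| <= primes #|M|} := piSg sHM.
have [le_MH | lt_HM] := leqP (size (primes #|M|)) (size (primes #|H|)).
  by rewrite (eqP (_ : _ - _ == 0)) ?subn_eq0 // addn0; apply: deep_sub dM.
have /hasP[q Mq Hq] : has [pred q | q \notin primes #|H|] (primes #|M|).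
  apply: contraTT lt_HM => /hasPn nH; rewrite -leqNgt uniq_leq_size ?primes_uniq //.
  by move=> q /nH /negPn.
have q'H : q^'.-group H.
  by rewrite /pgroup p'natEpi.
have [K hK sHK] := Hall_superset solM sHM q'H.
have sKM := pHall_sub hK.
have size_K : size (primes #|M|) = (size (primes #|K|)).+1.
  rewrite (card_Hall hK) primes_part size_filter -(count_predC (mem q^') (primes #|M|)).
  rewrite -addn1; congr (_ + _)%N.
  rewrite (@eq_count _ _ (pred1 q)) ?count_uniq_mem ?primes_uniq ?Mq // => s.
  by rewrite /= !inE negbK.
have prKM : K \proper M.
  rewrite properEneq sKM andbT; apply: contra_eq_neq size_K => ->.
  by rewrite -[X in X != _]addn0 -addn1 eqn_add2l.
have := IHn K k.+1 _ (solvableS sKM solM) sHK (deep_proper prKM dM).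
rewrite size_K subSn; last by rewrite uniq_leq_size ?primes_uniq //; apply: piSg.
rewrite addSnnS; apply.
exact: leq_trans (proper_card prKM) leMn.
Qed.

End Deep.

Section Subnormal.

Variables (F : group_class) (m : nat -> nat).
Hypotheses (formF : formation F) (F1 : forall gT : finGroupType, F _ [1 gT]%G).
Hypothesis satF : saturated F.
Hypothesis FP : forall (gT : finGroupType) (G : {group gT}),
  F _ G <-> solvable G /\ forall p, prime p -> pnil p (abres (m p) G).

(** The p'-elements of the verbal subgroup lie in its p'-core, which is normal in [G] and coprime to
    [Q]. *)
Lemma formation_abres_cent p (gT : finGroupType) (G Q : {group gT}) x :
  prime p -> F _ G -> Q <| G -> p.-group Q ->
  x \in abres (m p) G -> p^'.-elt x -> x \in 'C(Q).
Proof.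
move=> pr_p /FP[_ /(_ p pr_p) hG] nQG pQ Vx p'x.
have Ox := mem_pnil_core hG Vx p'x.
apply: (subsetP (coprime_normal_cent _ nQG _)) Ox.
  by apply: gFnormal_trans (abres_normal _ _).
by rewrite coprime_sym (pnat_coprime pQ) //; apply: pcore_pgroup.
Qed.

Variable gT : finGroupType.
Implicit Types G H K M P X : {group gT}.

Lemma F_subnormal_sub G H : F_subnormal F G H -> H \subset G.
Proof.
elim=> // {}H M maxH _ _; apply: subset_trans.
exact: proper_sub (maxgroupp maxH).
Qed.

(** Go up the chain from [X] to the step [X < Y] at which it first contains [M]. There
    [X :&: M = H], and [M] modulo its intersection with [gcore X Y] embeds in [Y / gcore X Y]; this
    intersection lies in [gcore H M]. *)
Lemma F_subnormal_maximal G X : F_subnormal F G X ->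
  forall H M, maximal H M -> M \subset G -> H \subset X -> ~~ (M \subset X) ->
  F _ (M / gcore H M)%G.
Proof.
elim=> {X} [|X Y maxX FY snY IHY] H M maxH sMG sHX; first by rewrite sMG.
move=> nsMX; have sXY := maxgroupp maxX.
have [sMY | nsMY] := boolP (M \subset Y); last first.
  by apply: IHY nsMY => //; apply: subset_trans sHX (proper_sub _).
have [/proper_sub sHM uH] := maxgroupP maxH.
have eqH : X :&: M = H.
  by apply: uH; rewrite ?subsetI ?sHX // /proper subsetIr subsetI subxx andbT.
set C := gcore X Y in FY *.
have nCY : C <| Y by rewrite /normal gcore_norm (subset_trans (gcore_sub _ _)) ?proper_sub.
have sCX : C \subset X := gcore_sub _ _.
have nCM : C :&: M <| M by rewrite setIC; apply: normalGI nCY.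
have FM : F _ (M / (C :&: M))%G.
  have FMC : F _ (M / C)%G by apply: (formationS FP) FY; apply: quotientS.
  apply: in_class_isog FMC; rewrite isog_sym; apply: second_isog.
  exact: subset_trans sMY (normal_norm nCY).
apply: formation_quotient_residual => //.
  apply: subset_trans (residual_sub_normal nCM FM) _.
  by apply: gcore_max; rewrite ?normal_norm //= -eqH setSI.
by rewrite /normal gcore_norm andbT (subset_trans (gcore_sub _ _)).
Qed.

(** The residual lies in the core of every maximal subgroup, hence in ['Phi(M)], and saturation
    applies. *)
Lemma saturated_maximal M :
  (forall K, maximal K M -> F _ (M / gcore K M)%G) -> F _ M.
Proof.
move=> FM; apply: satF; apply: formation_quotient_residual; rewrite ?Phi_normal //.
apply/bigcapsP=> K /predU1P[-> | maxK].
  by apply: normal_sub; apply: residual_normal.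
apply: subset_trans (gcore_sub K M); apply: residual_sub_normal; last exact: FM.
rewrite /normal gcore_norm andbT (subset_trans (gcore_sub _ _)) //.
exact: proper_sub (maxgroupp maxK).
Qed.

Lemma F_subnormal_deep k G H :
  (forall K, n_maximal k.+1 K G -> F_subnormal F G K) -> deep k H G -> F _ H.
Proof.
move=> snG [M nM sHM]; apply: (formationS FP sHM); apply: saturated_maximal => K maxK.
have prKM := maxgroupp maxK.
apply: (F_subnormal_maximal (snG K _) maxK) => //; last exact: proper_subn.
  by exists M.
exact: n_maximal_sub nM.
Qed.

(* In each step H < M of the chain, M / core is in F, so x acts trivially on the
   part of P in it; coprime action then lifts C(H :&: P) to C(M :&: P). *)
Lemma F_subnormal_abres_cent p G H P x : prime p -> F_subnormal F G H ->
  P <| G -> p.-group P -> x \in abres (m p) H -> p^'.-elt x ->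
  x \in 'C(H :&: P) -> x \in 'C(P).
Proof.
move=> pr_p snH nPG pP; elim: snH => [|{}H M maxH FM snM IHM] Vx p'x cx.
  by move: cx; rewrite (setIidPr (normal_sub nPG)).
have prHM := maxgroupp maxH; have sHM := proper_sub prHM.
have VMx : x \in abres (m p) M by apply: subsetP Vx; apply: abresS.
apply: IHM => //; pose Q := (M :&: P)%G; pose C := gcore_group H M.
have sMG : M \subset G by apply: F_subnormal_sub snM.
have nQM : Q <| M by apply: normalGI nPG.
have nCM : C <| M.
  by rewrite /normal gcore_norm andbT (subset_trans (gcore_sub _ _)).
have pQ : p.-group Q by apply: pgroupS pP; apply: subsetIr.
have sxM : <[x]> \subset M.
  by rewrite cycle_subG; apply: subsetP VMx; apply: abres_sub.
have nCx : <[x]> \subset 'N(C) := subset_trans sxM (normal_norm nCM).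
have nQx : <[x]> \subset 'N(Q) := subset_trans sxM (normal_norm nQM).
have nCQ : Q \subset 'N(C) := subset_trans (normal_sub nQM) (normal_norm nCM).
suff: <[x]> \subset 'C(Q) by rewrite cycle_subG.
apply: (@coprime_stable_cent _ _ _ (C :&: Q)%G) => //=.
- exact: normsI.
- exact: subsetIr.
- by apply: pnat_coprime pQ _; rewrite -orderE.
- exact: pgroup_sol pQ.
- exact: normsI (normG _).
- rewrite subsetI commg_subl nQx andbT -quotient_cents2 // centsC.
  rewrite quotient_cycle ?cycle_subG; last by rewrite -cycle_subG.
  apply: (@formation_abres_cent p _ (M / C)) => //.
  + exact: quotient_normal.
  + exact: quotient_pgroup.
  + rewrite -quotient_abres ?normal_norm // mem_quotient //.
  + by apply: morph_p_elt => //; rewrite -cycle_subG.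
- rewrite cycle_subG; apply: subsetP cx; apply: centS.
  rewrite /= setIA (setIidPl (normal_sub nCM)); apply: setSI.
  exact: gcore_sub.
Qed.

End Subnormal.

(** * Ore dispersive groups *)

Definition duo (q r : nat) : nat_pred := [pred s | (s == q) || (s == r)].

Definition geq_pi (p : nat) : nat_pred := [pred s | p <= s].

Section Ore.

Variable gT : finGroupType.
Implicit Types G H K R : {group gT}.

(** As [d < q < r], every r-element is a power of its [d]-th power, so the verbal subgroup contains
    the Sylow r-subgroups. Its q'-core is then one of them and is normal in [G]. *)
Lemma duo_pnil_Hall (q r d : nat) G :
  prime q -> prime r -> q < r -> d %| q.-1 -> (duo q r).-group G ->
  pnil q (abres d G) -> r.-Hall(G) 'O_r(G).
Proof.
move=> pr_q pr_r lt_qr dvd_d duoG hV; set V := abres d G in hV.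
have sVG : V \subset G := abres_sub d G.
have d_gt0 : 0 < d by apply: dvdn_gt0 dvd_d; rewrite -subn1 subn_gt0 prime_gt1.
have lt_dr : d < r.
  apply: leq_ltn_trans lt_qr; apply: leq_trans (leq_pred q).
  by apply: dvdn_leq dvd_d; rewrite -subn1 subn_gt0 prime_gt1.
have [R sylR] := Sylow_exists r G; have [sRG rR _] := and3P sylR.
have sRV : R \subset V.
  apply/subsetP=> x Rx; have Vxd : x ^+ d \in V by apply: mem_abres_exp; apply: (subsetP sRG).
  have co_xd : coprime #[x] d.
    apply: pnat_coprime (mem_p_elt rR Rx) _.
    by rewrite p'natE //; apply/negP=> /(dvdn_leq d_gt0); rewrite leqNgt lt_dr.
  have /eqP defx : generator <[x]> (x ^+ d) by rewrite generator_coprime.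
  by rewrite -cycle_subG defx cycle_subG.
have q'R : q^'.-group R.
  by apply: sub_in_pnat rR => s _ /eqnP->; rewrite !inE eq_sym neq_ltn lt_qr.
set W := 'O_q^'(V) in hV; have nWV : W <| V := pcore_normal _ _.
have sRW : R \subset W by rewrite (sub_normal_Hall hV).
have nWG : W <| G by apply: gFnormal_trans (abres_normal _ _).
have rW : r.-group W.
  have : (duo q r).-group W by apply: pgroupS duoG; apply: normal_sub.
  move=> duoW; have q'W : q^'.-group W by apply: pcore_pgroup.
  apply/pgroupP=> s pr_s s_dvd; have := pgroupP duoW s pr_s s_dvd.
  have := pgroupP q'W s pr_s s_dvd.
  by rewrite !inE => /negPf->.
have defW : W :=: R by apply: sub_pHall sylR rW sRW (normal_sub nWG).
have sylW : r.-Sylow(G) W by rewrite defW.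
by rewrite (normal_Hall_pcore sylW nWG).
Qed.

(** Ore dispersivity tested on biprimary subgroups; for a soluble group it implies the full
    property. *)
Definition duo_Ore G := forall (q r : nat) H, prime q -> prime r -> q < r ->
  H \subset G -> (duo q r).-group H -> r.-Hall(H) 'O_r(H).

Lemma duo_OreS G H : H \subset G -> duo_Ore G -> duo_Ore H.
Proof.
move=> sHG oG q r K pr_q pr_r lt_qr sKH; apply: oG => //.
exact: subset_trans sHG.
Qed.

(** For each prime [s], a Hall {s, r}-subgroup containing [R] normalises it, so the order of the
    normaliser of [R] has the same [s]-part as [#|G|]. *)
Lemma duo_Ore_max_normal G R r : solvable G -> duo_Ore G -> prime r ->
  (forall s, s \in primes #|G| -> s <= r) -> r.-Sylow(G) R -> R <| G.
Proof.
move=> solG oG pr_r max_r sylR; have [sRG rR _] := and3P sylR.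
rewrite /normal sRG; suff dvdGN : #|G| %| #|'N_G(R)|.
  by apply/setIidPl/eqP; rewrite eqEcard subsetIl dvdn_leq.
apply/dvdn_partP => // s Gs.
have pr_s : prime s by move: Gs; rewrite mem_primes => /and3P[].
have := max_r s Gs; rewrite leq_eqVlt => /predU1P[-> | lt_sr].
  by rewrite -(card_Hall sylR) cardSg // subsetI sRG normG.
have duoR : (duo s r).-group R.
  by apply: sub_in_pnat rR => t _ /eqnP->; rewrite !inE eqxx orbT.
have [H hH sRH] := Hall_superset solG sRG duoR.
have sHG := pHall_sub hH.
have nRH : H \subset 'N(R).
  have sylRH : r.-Sylow(H) R := pHall_subl sRH sHG sylR.
  have hR := oG s r H pr_s pr_r lt_sr sHG (pHall_pgroup hH).
  have sRO : R \subset 'O_r(H) by rewrite (sub_normal_Hall hR) ?pcore_normal.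
  by rewrite -(sub_pHall sylRH (pcore_pgroup r H) sRO (pcore_sub r H)) gFnorm.
have -> : (#|G|`_s = #|H|`_s)%N.
  by rewrite (card_Hall hH) partn_part // => t; rewrite !inE => ->.
by apply: dvdn_trans (dvdn_part _ _) (cardSg _); rewrite subsetI sHG.
Qed.

End Ore.

Lemma duo_Ore_quotient (gT : finGroupType) (G R : {group gT}) :
  solvable G -> R <| G -> duo_Ore G -> duo_Ore (G / R).
Proof.
move=> solG nRG oG q r Hb pr_q pr_r lt_qr sHb duoH.
have [L defL sRL sLG] := inv_quotientS nRG sHb; rewrite defL in duoH *.
have [H hH] := Hall_exists (duo q r) (solvableS sLG solG).
have sHL := pHall_sub hH; have nRL := subset_trans sLG (normal_norm nRG).
have defHR : H / R = L / R.
  have hHR : (duo q r).-Hall(L / R) (H / R).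
    by apply: quotient_pHall hH; apply: subset_trans nRL.
  apply/eqP; rewrite eqEcard quotientS //= (card_Hall hHR).
  by rewrite part_pnat_id.
have hr := oG q r H pr_q pr_r lt_qr (subset_trans sHL sLG) (pHall_pgroup hH).
rewrite /= -defHR.
have nRH := subset_trans sHL nRL.
have hrR : r.-Hall(H / R) ('O_r(H) / R).
  apply: quotient_pHall hr; exact: subset_trans (pcore_sub _ _) nRH.
have nOR : 'O_r(H) / R <| H / R by apply: quotient_normal; apply: pcore_normal.
by rewrite (normal_Hall_pcore hrR nOR).
Qed.

(** Induction on the order, factoring out the normal Sylow subgroup for the largest prime
    divisor. *)
Lemma duo_Ore_Hall (gT : finGroupType) (G : {group gT}) p :
  solvable G -> duo_Ore G -> (geq_pi p).-Hall(G) 'O_(geq_pi p)(G).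
Proof.
have [n] := ubnP #|G|; elim: n gT G => // n IHn gT G /ltnSE-leGn solG oG.
have [pi'G | npi'G] := boolP ((geq_pi p)^'.-group G).
  have -> : 'O_(geq_pi p)(G) = 1.
    apply: card1_trivg; rewrite -(part_pnat_id (pcore_pgroup _ _)).
    apply/eqP; rewrite partn_eq1 ?cardG_gt0 //.
    exact: pgroupS (pcore_sub _ _) pi'G.
  by rewrite /pHall sub1G pgroup1 indexg1.
have ntG : G :!=: 1 by apply: contraNneq npi'G => ->; apply: pgroup1.
pose r := max_pdiv #|G|.
have G_gt1 : 1 < #|G| by rewrite cardG_gt1.
have pr_r : prime r by apply: max_pdiv_prime.
have max_r s : s \in primes #|G| -> s <= r by apply: max_pdiv_max.
have le_pr : p <= r.
  apply: contraR npi'G; rewrite -ltnNge => lt_rp.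
  apply/pgroupP=> s pr_s s_dvd; rewrite !inE -ltnNge.
  by apply: leq_ltn_trans lt_rp; apply: max_r; rewrite mem_primes pr_s cardG_gt0.
have [R sylR] := Sylow_exists r G.
have nRG := duo_Ore_max_normal solG oG pr_r max_r sylR.
have rR := pHall_pgroup sylR.
have ntR : R :!=: 1.
  rewrite -cardG_gt1 (card_Hall sylR) p_part_gt1.
  by rewrite mem_primes pr_r cardG_gt0 max_pdiv_dvd.
have piR : (geq_pi p).-group R by apply: sub_in_pnat rR => s _ /eqnP->.
have := IHn _ (G / R)%G _ (quotient_sol R solG) (duo_Ore_quotient solG nRG oG).
rewrite /= pquotient_pcore // pquotient_pHall //; last first.
  by rewrite /normal pcore_max // (subset_trans (pcore_sub _ _)) ?normal_norm.
apply; apply: leq_trans leGn; exact: ltn_quotient ntR (normal_sub nRG).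
Qed.

Lemma duo_Ore_dispersive (gT : finGroupType) (G : {group gT}) :
  solvable G -> duo_Ore G -> Ore_dispersive G.
Proof.
move=> solG oG p _; exists 'O_(geq_pi p)(G)%G; first exact: pcore_normal.
rewrite (card_Hall (duo_Ore_Hall p solG oG)) -(@filter_pi_of #|G| #|G|.+1) //.
rewrite big_filter_cond /partn big_mkcond [RHS]big_mkcond /=.
apply: eq_bigr => q _; rewrite inE andbC; case: (p <= q) => //=.
case: ifP => // Gq; move: (logn_gt0 q #|G|); rewrite -[q \in primes _]/(q \in \pi(_)) Gq.
by case: (logn q #|G|).
Qed.

(** * Coprime action *)

Section SylowLemmas.

Variable gT : finGroupType.
Implicit Types A B C D E G H K L M N P Q R S W : {group gT}.

Lemma Sylow_cover D H :
  (forall q, q \in \pi(D) -> exists2 E : {group gT}, q.-Sylow(D) E & E \subset H) ->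
  D \subset H.
Proof.
move=> coverD; apply/setIidPl/eqP; rewrite eqEcard subsetIl /=.
apply: dvdn_leq => //; apply/dvdn_partP => // q /coverD[E sylE sEH].
by rewrite -(card_Hall sylE) cardSg // subsetI (pHall_sub sylE).
Qed.

(** A Hall pi-subgroup of the preimage of [Eb] maps onto [Eb], so lifting introduces no new
    primes. *)
Lemma quotient_pi_lift (pi : nat_pred) D C (Eb : {group coset_of C}) :
  D \subset 'N(C) -> solvable D -> Eb \subset D / C -> pi.-group Eb ->
  exists H : {group gT}, [/\ H \subset D, pi.-group H & H / C = Eb].
Proof.
move=> nCD solD sED piE; pose L := (D :&: coset C @*^-1 Eb)%G.
have sLD : L \subset D := subsetIl _ _.
have nCL := subset_trans sLD nCD.
have defL : L / C = Eb.
  apply/eqP; rewrite eqEsubset; apply/andP; split.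
    by rewrite sub_quotient_pre ?subsetIr.
  apply/subsetP=> x Ex; have /morphimP[y Ny Dy defx] := subsetP sED x Ex.
  by rewrite defx mem_quotient // inE Dy mem_morphpre // -defx.
have [H hH] := Hall_exists pi (solvableS sLD solD).
have sHL := pHall_sub hH.
exists H; split; [exact: subset_trans sLD | exact: pHall_pgroup hH |].
have hHC : pi.-Hall(L / C) (H / C) by apply: quotient_pHall hH; apply: subset_trans nCL.
apply/eqP; rewrite -defL eqEcard quotientS //= (card_Hall hHC).
by rewrite part_pnat_id //= defL.
Qed.

Lemma size_primes_leq H (s : seq nat) :
  {subset primes #|H| <= s} -> size (primes #|H|) <= size s.
Proof. by apply: uniq_leq_size; apply: primes_uniq. Qed.

Lemma size_primesS H K :
  H \subset K -> size (primes #|H|) <= size (primes #|K|).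
Proof. by move=> sHK; apply: size_primes_leq; apply: piSg. Qed.

Lemma size_primes_pgroup (p : nat) P : p.-group P -> size (primes #|P|) <= 1.
Proof.
move=> pP; apply: (@leq_trans (size [:: p])) => //; apply: size_primes_leq => q.
rewrite mem_primes inE => /and3P[pr_q _ q_dvd].
by have := pgroupP pP q pr_q q_dvd; rewrite inE.
Qed.

Lemma size_primes_duo q s H : (duo q s).-group H -> size (primes #|H|) <= 2.
Proof.
move=> duoH; apply: (@leq_trans (size [:: q; s])) => //; apply: size_primes_leq => t.
rewrite mem_primes !inE => /and3P[pr_t _ t_dvd].
by have := pgroupP duoH t pr_t t_dvd; rewrite inE.
Qed.

Lemma size_primes_join A B : B \subset 'N(A) ->
  size (primes #|A <*> B|) <= size (primes #|A|) + size (primes #|B|).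
Proof.
move=> nAB; rewrite -size_cat; apply: size_primes_leq => q.
rewrite mem_cat !mem_primes !cardG_gt0 /= norm_joinEr // => /andP[pr_q q_dvd].
by rewrite pr_q -Euclid_dvdM // mul_cardG dvdn_mulr.
Qed.

Lemma card_coprime_join A B : B \subset 'N(A) -> coprime #|A| #|B| ->
  #|A <*> B| = (#|A| * #|B|)%N.
Proof. by move=> nAB coAB; rewrite norm_joinEr // coprime_cardMg. Qed.

Lemma der1_cent_cyclic G Q : G \subset 'N(Q) -> cyclic Q -> G^`(1) \subset 'C(Q).
Proof.
move=> nQG cycQ; rewrite gen_subG; apply/subsetP=> _ /imset2P[x y Gx Gy ->].
have [nx ny] := (subsetP nQG x Gx, subsetP nQG y Gy).
have : [~ x, y] \in 'ker_G (conj_aut Q).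
  rewrite inE groupR //; apply/kerP; rewrite ?groupR // morphR //.
  by apply/eqP/commgP/(centsP (Aut_cyclic_abelian cycQ)); apply: Aut_aut.
by rewrite ker_conj_aut // inE => /andP[].
Qed.

(** A Sylow subgroup lies, with some Sylow s-subgroup, in an abelian Hall subgroup for two primes;
    so it centralises a Sylow subgroup for every prime, and [G] is abelian. The exponent is read off
    from elements of prime power order. *)
Lemma abres_biprimary d G : solvable G ->
  (forall E, E \subset G -> size (primes #|E|) <= 1 -> abres d E = 1) ->
  (forall E, E \subset G -> size (primes #|E|) <= 2 -> abelian E) ->
  abres d G = 1.
Proof.
move=> solG ab1 ab2.
have abG : abelian G.
  apply: Sylow_cover => q _; have [Q sylQ] := Sylow_exists q G; exists Q => //.
  rewrite centsC; apply: Sylow_cover => s _.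
  have [sQG qQ _] := and3P sylQ.
  have duoQ : (duo q s).-group Q.
    by apply: sub_in_pnat qQ => t _ /eqnP->; rewrite !inE eqxx.
  have [H hH sQH] := Hall_superset solG sQG duoQ; have sHG := pHall_sub hH.
  have [S sylS] := Sylow_exists s H; exists S.
    apply: subHall_Sylow hH _ sylS; by rewrite !inE eqxx orbT.
  apply: (centSS (pHall_sub sylS) sQH).
  by apply: ab2 sHG _; apply: size_primes_duo (pHall_pgroup hH).
apply/eqP/abres_trivP; split=> // x Gx; apply/eqP; rewrite -order_dvdn.
apply/dvdn_partP; rewrite ?order_gt0 // => q _; rewrite -order_constt order_dvdn.
have sxG : <[x.`_q]> \subset G by rewrite cycle_subG groupX.
have /eqP/abres_trivP[_ ->] // : abres d <[x.`_q]> = 1; last exact: cycle_id.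
apply: ab1 sxG _; apply: (@size_primes_pgroup q); rewrite -/(p_elt _ _).
exact: p_elt_constt.
Qed.

End SylowLemmas.

Section CoprimeAction.

Variable gT : finGroupType.
Implicit Types A B C D E G H K L M N P Q R S W : {group gT}.

(** Pass to [D / 'C(Q)], whose subgroups lift to subgroups of [D] with no further primes. *)
Lemma abres_biprimary_cent d D Q : D \subset 'N(Q) -> solvable D ->
  (forall E, E \subset D -> size (primes #|E|) <= 1 -> abres d E \subset 'C(Q)) ->
  (forall E, E \subset D -> size (primes #|E|) <= 2 -> E^`(1) \subset 'C(Q)) ->
  abres d D \subset 'C(Q).
Proof.
move=> nQD solD ab1 ab2; have nCD : D \subset 'N('C(Q)) by apply: norms_cent.
suff: abres d (D / 'C(Q)) = 1.
  rewrite -quotient_abres // => V1; rewrite -quotient_sub1 ?V1 //.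
  exact: subset_trans (abres_sub _ _) nCD.
have lift (Eb : {group coset_of 'C(Q)}) : Eb \subset D / 'C(Q) ->
    exists E, [/\ E \subset D, size (primes #|E|) <= size (primes #|Eb|) & E / 'C(Q) = Eb].
  move=> sED; have piE := pgroup_pi Eb.
  have [E [sE pE defE]] := quotient_pi_lift nCD solD sED piE.
  exists E; split=> //; apply: size_primes_leq => q.
  rewrite mem_primes => /and3P[pr_q _ q_dvd]; exact: (pgroupP pE q pr_q q_dvd).
apply: abres_biprimary; first exact: quotient_sol.
  move=> Eb /lift[E [sED leE defE]] le1; rewrite -defE.
  rewrite -quotient_abres; last exact: subset_trans sED nCD.
  by apply: quotientS1; apply: ab1 (leq_trans leE le1).
move=> Eb /lift[E [sED leE defE]] le2; rewrite -defE; apply: sub_der1_abelian.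
exact: ab2 (leq_trans leE le2).
Qed.

(* Maschke's theorem, lifted from the Frattini quotient. *)
Lemma Phi_complement (p : nat) D P S : p.-group P -> p^'.-group D -> D \subset 'N(P) ->
  'Phi(P) \subset S -> S \subset P -> D \subset 'N(S) ->
  exists W, [/\ W \subset P, D \subset 'N(W), S * W = P & S :&: W \subset 'Phi(P)].
Proof.
move=> pP p'D nPD sPhiS sSP nSD.
have nPhiP : 'Phi(P) <| P := Phi_normal P.
have nPhiD : D \subset 'N('Phi(P)) by apply: gFnorm_trans.
have nPhiS := normalS sPhiS sSP nPhiP.
set V := P / 'Phi(P); set U := S / 'Phi(P); set G := (P <*> D) / 'Phi(P).
have abV : p.-abelem V by apply: Phi_quotient_abelem.
have sUV : U \subset V by apply: quotientS.
have nVG : V <| G.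
  by apply: quotient_normal; rewrite /normal joing_subl join_subG normG nPD.
have abU : abelian U by apply: abelianS sUV (abelem_abelian abV).
have nUG : U <| G.
  apply: quotient_normal; rewrite /normal (subset_trans sSP) ?joing_subl //=.
  rewrite join_subG nSD andbT sub_der1_norm // (subset_trans _ sPhiS) //.
  by apply: der1_min (abelem_abelian abV); apply: normal_norm.
have defG : G = V * (D / 'Phi(P)).
  by rewrite -quotientMl ?normal_norm // -norm_joinEr.
have pV := abelem_pgroup abV.
have coU : coprime #|U| #|G : V|.
  apply: pnat_coprime (pgroupS sUV pV) _.
  rewrite -card_quotient ?normal_norm // -[_.-nat _]/(p^'.-group _) /= -/G defG.
  by rewrite quotientMidl !quotient_pgroup.
(* By Gaschutz, [U] splits in [G] because it splits in the elementary abelian [V] of index prime to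
   [p]; the intersection of a complement with [V] is invariant under [D]. *)
have : [splits G, over U].
  rewrite (Gaschutz_split nUG sUV (normal_sub nVG) abU coU).
  exact: abelem_splits abV sUV.
case/splitsP=> C /complP[tiUC mulUC].
have sWV : V :&: C \subset V := subsetIl _ _.
have [W defW sPhiW sWP] := inv_quotientS nPhiP sWV.
have nPhiW := normalS sPhiW sWP nPhiP.
exists W; split=> //.
- rewrite -(quotientGK nPhiW) norm_quotient_pre // -defW.
  have sDG : D / 'Phi(P) \subset G by rewrite quotientS ?joing_subr.
  apply: subset_trans sDG _; rewrite -mulUC mul_subG //.
    by rewrite cents_norm // (sub_abelian_cent2 (abelem_abelian abV)).
  have sCG : C \subset G by rewrite -mulUC mulG_subr.
  by rewrite normsI ?normG // (subset_trans sCG) ?normal_norm.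
- apply/eqP; rewrite eqEsubset mul_subG //= -(mulSGid sPhiS) -mulgA.
  rewrite -quotientSK ?normal_norm // quotientMl ?normal_norm // -defW.
  rewrite /= -/U -/V setIC group_modl // mulUC subsetI subxx andbT.
  exact: normal_sub nVG.
- rewrite -quotient_sub1; last first.
    by apply: subset_trans (normal_norm nPhiS); apply: subsetIl.
  rewrite -tiUC (subset_trans (quotientI _ _ _)) // -defW.
  by rewrite setIS ?subsetIr.
Qed.

(** The first term of the cyclic series that meets [N] nontrivially contains [N], which then embeds
    in a cyclic factor. *)
Lemma supersoluble_minnormal_cyclic G N :
  supersoluble G -> minnormal N G -> N \subset G -> cyclic N.
Proof.
move=> [s sP defG] /mingroupP[/andP[ntN nNG] minN] sNG.
have : N :&: 1%G == 1 by rewrite setIC setI1g.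
have : N :&: last 1%G s != 1 by rewrite defG (setIidPl sNG).
have : 1%G <| G by apply: normal1.
elim: s 1%G sP {defG} => /= [|H s IHs] K; first by move=> _ _ /negPf->.
case/andP=> /and3P[sKH nHG cycHK] sP nKG nt1 tiNK.
have [tiNH | ntNH] := eqVneq (N :&: H) 1.
  by apply: (IHs H) => //; apply/eqP.
have sNH : N \subset H.
  apply/setIidPl/(minN (N :&: H)%G); last exact: subsetIl.
  by rewrite /= ntNH normsI // normal_norm.
have nKN := subset_trans sNG (normal_norm nKG).
rewrite (isog_cyclic (quotient_isog nKN _)); last by apply/eqP; rewrite setIC.
by apply: cyclicS cycHK; apply: quotientS.
Qed.

End CoprimeAction.

(** * Sylow subgroups for bad primes *)

Lemma proper_join (gT : finGroupType) (S P E : {group gT}) :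
  E \subset 'N(S) -> E \subset 'N(P) -> coprime #|P| #|E| ->
  S \proper P -> S <*> E \proper P <*> E.
Proof.
move=> nSE nPE coPE prSP; have sSP := proper_sub prSP.
rewrite properEcard genS ?setSU //= !card_coprime_join //; last first.
  exact: coprimeSg coPE.
by rewrite ltn_pmul2r // proper_card.
Qed.

Lemma proper_joinl (gT : finGroupType) (R X Y : {group gT}) :
  Y \subset 'N(R) -> coprime #|R| #|Y| -> X \proper Y -> R <*> X \proper R <*> Y.
Proof.
move=> nRY coRY prXY; have sXY := proper_sub prXY.
rewrite properEcard genS ?setUS //= !card_coprime_join //.
- by rewrite ltn_pmul2l // proper_card.
- exact: subset_trans nRY.
- exact: coprimegS coRY.
Qed.

Section Structure.

Variables (F : group_class) (m : nat -> nat).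
Hypotheses (formF : formation F) (F1 : forall gT : finGroupType, F _ [1 gT]%G).
Hypothesis FP : forall (gT : finGroupType) (G : {group gT}),
  F _ G <-> solvable G /\ forall p, prime p -> pnil p (abres (m p) G).
Hypotheses (superF : sub_class F supersoluble).
Hypotheses (m_dvd : forall p, prime p -> m p %| p.-1).

Variables (gT : finGroupType) (G : {group gT}) (k : nat).
Hypotheses (solG : solvable G) (sizeG : k.+2 <= size (primes #|G|)).
Hypothesis deepF : forall H : {group gT}, deep k H G -> F _ H.

Implicit Types A B C D E H K L M N P Q R S T W : {group gT}.

Lemma abres_join_cent p Q H : prime p -> p.-group Q -> p^'.-group H ->
  H \subset 'N(Q) -> F _ (Q <*> H)%G -> abres (m p) H \subset 'C(Q).
Proof.
move=> pr_p pQ p'H nQH FQH; apply/subsetP=> x Vx.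
have p'V : p^'.-group (abres (m p) H) := pgroupS (abres_sub _ _) p'H.
apply: (@formation_abres_cent F m FP p _ (Q <*> H)%G) => //.
- by rewrite /normal joing_subl join_subG normG.
- by apply: subsetP Vx; apply: abresS; apply: joing_subr.
- exact: mem_p_elt p'V Vx.
Qed.

Lemma deep_size H : H \subset G -> deep (size (primes #|G|) - size (primes #|H|)) H G.
Proof. by move=> sHG; have := deep_primes solG sHG (deep0 (subxx G)). Qed.

(** [G] has at least [k + 2] prime divisors, so descending to at most two of them leaves room for
    [k] strict inclusions. *)
Lemma formation_size2 H : H \subset G -> size (primes #|H|) <= 2 -> F _ H.
Proof.
move=> sHG le2; apply/deepF/deep_leq/(deep_size sHG).
by rewrite leq_subRL; lia.
Qed.

Lemma formation_size3 H M : H \proper M -> M \subset G ->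
  size (primes #|M|) <= 3 -> F _ H.
Proof.
move=> prHM sMG le3; apply/deepF/deep_leq/(deep_proper prHM (deep_size sMG)).
lia.
Qed.

Lemma formation_size4 H M L : H \proper M -> M \proper L -> L \subset G ->
  size (primes #|L|) <= 4 -> F _ H.
Proof.
move=> prHM prML sLG le4.
apply/deepF/deep_leq/(deep_proper prHM (deep_proper prML (deep_size sLG))).
lia.
Qed.

Lemma duo_Ore_structure : duo_Ore G.
Proof.
move=> q r H pr_q pr_r lt_qr sHG duoH.
have le2 : size (primes #|H|) <= 2 by apply: size_primes_duo duoH.
have /FP[_ /(_ q pr_q) hq] := formation_size2 sHG le2.
exact: duo_pnil_Hall (m_dvd pr_q) duoH hq.
Qed.

Section Prime.

Variables (p : nat) (P D : {group gT}).
Hypotheses (pr_p : prime p) (sPG : P \subset G) (sDG : D \subset G).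
Hypotheses (pP : p.-group P) (p'D : p^'.-group D) (nPD : D \subset 'N(P)).

Let coPE E : E \subset D -> coprime #|P| #|E|.
Proof. by move=> sED; apply: pnat_coprime pP (pgroupS sED p'D). Qed.

Let size_PE E : E \subset D ->
  size (primes #|P <*> E|) <= (size (primes #|E|)).+1.
Proof.
move=> sED; apply: leq_trans (size_primes_join (subset_trans sED nPD)) _.
by rewrite -[X in _ <= X]add1n leq_add2r (size_primes_pgroup pP).
Qed.

Let sPEG E : E \subset D -> P <*> E \subset G.
Proof. by move=> sED; rewrite join_subG sPG (subset_trans sED). Qed.

Lemma abres_cent_size1 E : E \subset D -> size (primes #|E|) <= 1 ->
  abres (m p) E \subset 'C(P).
Proof.
move=> sED le1; apply: abres_join_cent => //.
- exact: pgroupS sED p'D.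
- exact: subset_trans nPD.
- by apply: formation_size2 (sPEG sED) (leq_trans (size_PE sED) _).
Qed.

(** For [E <= D] with at most two prime divisors, [S E < P E] is a strict inclusion in a group with
    at most three, so [S E] is in [F]. Such subgroups [E] decide the action of [D]. *)
Lemma abres_cent_proper S : S \proper P -> D \subset 'N(S) ->
  abres (m p) D \subset 'C(S).
Proof.
move=> prSP nSD; have ab2 E : E \subset D -> size (primes #|E|) <= 2 ->
    abres (m p) E \subset 'C(S).
  move=> sED le2; have nSE := subset_trans sED nSD.
  apply: abres_join_cent => //.
  - exact: pgroupS (proper_sub prSP) pP.
  - exact: pgroupS sED p'D.
  - apply: (formation_size3 (M := (P <*> E)%G)) (sPEG sED) (leq_trans (size_PE sED) _) => //.
    apply: proper_join (coPE sED) prSP => //; exact: subset_trans nPD.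
apply: abres_biprimary_cent => //; first exact: solvableS solG.
  by move=> E sED le1; apply: ab2 => //; apply: leqW.
move=> E sED le2; apply: subset_trans (ab2 E sED le2).
exact: der1_sub_abres.
Qed.

Hypothesis badP : ~~ (abres (m p) D \subset 'C(P)).

Let L := abres (m p) D.

Let sLD : L \subset D. Proof. exact: abres_sub. Qed.
Let nPL : L \subset 'N(P). Proof. exact: subset_trans nPD. Qed.

(** Otherwise [L] centralises the proper D-invariant subgroup [[~: P, L]] and also the quotient by
    it, hence [P] by coprime action. *)
Lemma bad_comm : [~: P, L] = P.
Proof.
apply/eqP; apply: contraR badP => neRP.
have prR : [~: P, L] \proper P.
  by rewrite properEneq neRP commg_subl.
have nRD : D \subset 'N([~: P, L]).
  by rewrite normsR // (subset_trans (normG D)) ?abres_norm.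
have cRL := abres_cent_proper prR nRD.
have nRP : P \subset 'N([~: P, L]) by apply: commg_norml.
apply: (@coprime_stable_cent _ _ P [group of [~: P, L]]) => //=.
- exact: subset_trans nRD.
- exact: proper_sub.
- exact: coPE.
- exact: pgroup_sol pP.
Qed.

Lemma bad_ntriv : P :!=: 1.
Proof. by apply: contraNneq badP => ->; apply: cents1. Qed.

(** Take a D-invariant [W] with [S * W = P] and [S :&: W] in ['Phi(P)]. If [W = P] the claim is
    immediate; otherwise [abres (m p) D] would centralise [S] and [W], hence [P]. *)
Lemma bad_irreducible S : 'Phi(P) \subset S -> S \subset P ->
  D \subset 'N(S) -> S :!=: P -> S \subset 'Phi(P).
Proof.
move=> sPhiS sSP nSD neSP.
have [W [sWP nWD mulSW tiSW]] := Phi_complement pP p'D nPD sPhiS sSP nSD.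
have [eqWP | neWP] := eqVneq (gval W) P.
  by move: tiSW; rewrite eqWP (setIidPl sSP).
case/negP: badP; rewrite -mulSW centM subsetI.
by rewrite !abres_cent_proper // properEneq ?neWP ?neSP.
Qed.

(* Otherwise P / Phi(P) would be E-irreducible, hence cyclic as PE is
   supersoluble, and D would act on it as an abelian group. *)
Lemma bad_split E : E \subset D -> size (primes #|E|) <= 1 ->
  exists P1 P2, [/\ P1 \proper P, P2 \proper P, P1 * P2 = P
                 & E \subset 'N(P1) /\ E \subset 'N(P2)].
Proof.
move=> sED le1; have nPE := subset_trans sED nPD.
have FPE : F _ (P <*> E)%G.
  by apply: formation_size2 (sPEG sED) (leq_trans (size_PE sED) _).
set Phi := 'Phi(P); have nPhiP : Phi <| P := Phi_normal P.
have nPhiD : D \subset 'N(Phi) by apply: gFnorm_trans.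
have nPhiPE : Phi <| P <*> E by apply: gFnormal_trans; rewrite /normal joing_subl join_subG normG.
have superPE : supersoluble (P <*> E / Phi)%G by apply/superF/formation_quotient.
have ntV : P / Phi != 1.
  by rewrite -subG1 quotient_sub1 ?normal_norm // proper_subn ?Phi_proper ?bad_ntriv.
have nVPE : (P <*> E) / Phi \subset 'N(P / Phi).
  by rewrite quotient_norms // join_subG normG.
have [U minU sUV] := minnormal_exists ntV nVPE.
have cycU : cyclic U.
  apply: supersoluble_minnormal_cyclic superPE minU _.
  exact: subset_trans sUV (quotientS _ (joing_subl _ _)).
have [/andP[ntU nUPE] _] := mingroupP minU.
have [S defU sPhiS sSP] := inv_quotientS nPhiP sUV.
have nPhiS := normalS sPhiS sSP nPhiP.
have nSE : E \subset 'N(S).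
  rewrite -(quotientGK nPhiS) norm_quotient_pre ?(subset_trans sED) // -defU.
  by apply: subset_trans nUPE; rewrite quotientS ?joing_subr.
have nsSPhi : ~~ (S \subset Phi).
  by rewrite -quotient_sub1 ?normal_norm // -defU subG1.
have [eqSP | neSP] := eqVneq (gval S) P.
  case/negP: badP; have cycV : cyclic (P / Phi).
    by rewrite defU /= in cycU; rewrite -eqSP.
  have cD : D^`(1) \subset 'C(P).
    apply: (coprime_Phi_cent pP (pgroupS (der_sub 1 D) p'D)).
      exact: subset_trans (der_sub 1 D) nPD.
    have nPhiD1 := subset_trans (der_sub 1 D) nPhiD.
    rewrite -quotient_cents2 //; last exact: normal_norm.
    rewrite centsC quotient_der //.
    by apply: (@der1_cent_cyclic _ _ (P / Phi)); rewrite ?quotient_norms.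
  apply: abres_biprimary_cent => //; first exact: solvableS solG.
    exact: abres_cent_size1.
  by move=> H sHD _; apply: subset_trans (dergS 1 sHD) cD.
have [W [sWP nWE mulSW tiSW]] :=
  Phi_complement pP (pgroupS sED p'D) nPE sPhiS sSP nSE.
exists S, W; split=> //; first by rewrite properEneq neSP.
rewrite properEneq sWP andbT; apply: contraNneq nsSPhi => eqWP.
by move: tiSW; rewrite eqWP (setIidPl sSP).
Qed.

(* For each Sylow subgroup E of D, P is the product of two proper E-invariant
   subgroups Q, and R Q E is in F, so [Q, E] centralises R; hence so does
   [P, D] = P. *)
Lemma bad_cent r R : prime r -> r.-group R -> R \subset G ->
  r^'.-group (P <*> D) -> P <*> D \subset 'N(R) -> P \subset 'C(R).
Proof.
move=> pr_r rR sRG r'PD nRPD; set C := 'C(R).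
have nCPD : P <*> D \subset 'N(C) := norms_cent nRPD.
have [nCP nCD] : P \subset 'N(C) /\ D \subset 'N(C).
  by apply/andP; rewrite -join_subG.
suff cDP : [~: P, D] \subset C.
  by apply: subset_trans cDP; rewrite -{1}bad_comm commgS.
rewrite -quotient_cents2 // centsC sub_quotient_pre //.
apply: (@Sylow_cover _ D [group of coset C @*^-1 'C(P / C)]) => q _.
have [E sylE] := Sylow_exists q D; exists E => //=.
have [sED qE _] := and3P sylE; have le1 := size_primes_pgroup qE.
have [P1 [P2 [prP1 prP2 mulP12 [nP1E nP2E]]]] := bad_split sED le1.
have nPE := subset_trans sED nPD.
have nCE := subset_trans sED nCD.
rewrite -sub_quotient_pre // -mulP12 quotientMl; last exact: subset_trans (proper_sub prP1) nCP.
have cPi Q : Q \proper P -> E \subset 'N(Q) -> E / C \subset 'C(Q / C).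
  move=> prQP nQE; have sQP := proper_sub prQP.
  have sQEPD : Q <*> E \subset P <*> D by rewrite genS // setUSS.
  have sPEPD : P <*> E \subset P <*> D by rewrite genS // setUS.
  rewrite quotient_cents2 //; last exact: subset_trans nCP.
  have cQE : abres (m r) (Q <*> E) \subset 'C(R).
    apply: abres_join_cent => //.
    - exact: pgroupS r'PD.
    - exact: subset_trans nRPD.
    apply: (formation_size3 (M := (R <*> (P <*> E))%G)).
    + apply: proper_joinl.
      * exact: subset_trans nRPD.
      * by apply: pnat_coprime rR (pgroupS sPEPD r'PD).
      * by apply: proper_join (coPE sED) prQP.
    + by rewrite join_subG sRG sPEG.
    apply: leq_trans (size_primes_join (subset_trans sPEPD nRPD)) _.
    rewrite -[3]/(1 + 2)%N leq_add ?(size_primes_pgroup rR) //.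
    exact: leq_trans (size_PE sED) _.
  apply: subset_trans cQE; rewrite commGC gen_subG.
  apply/subsetP=> _ /imset2P[x y Qx Ey ->]; apply: mem_abres_commg.
    by apply: subsetP Qx; apply: joing_subl.
  by apply: subsetP Ey; apply: joing_subr.
by rewrite centM subsetI !cPi.
Qed.

End Prime.

(** Ore dispersivity gives [G = K T] and [T = P D], where [K], [P] and [D] carry the primes above,
    equal to and below [p]. As [K] centralises [P], the latter is normal in [G]. *)
Lemma bad_structure p : prime p -> ~~ pnil p (abres (m p) G) ->
  exists D, [/\ p.-Sylow(G) 'O_p(G), D \subset G, p^'.-group D,
                (geq_pi p)^'.-group D & ~~ (abres (m p) D \subset 'C('O_p(G)))].
Proof.
move=> pr_p badp; have oG := duo_Ore_structure.
set K := 'O_(geq_pi p.+1)(G); have hK : (geq_pi p.+1).-Hall(G) K by apply: duo_Ore_Hall.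
have nKG : K <| G := pcore_normal _ _; have sKG := normal_sub nKG.
have /splitsP[T /complP[tiKT mulKT]] := SchurZassenhaus_split (pHall_Hall hK) nKG.
have sTG : T \subset G by rewrite -mulKT mulG_subr.
have sdT : K ><| T = G by rewrite sdprodE // (subset_trans sTG) ?normal_norm.
have hT : (geq_pi p.+1)^'.-Hall(G) T by apply/(sdprod_Hall_pcoreP hK).
have solT := solvableS sTG solG.
have oT := duo_OreS sTG oG.
set P := 'O_(geq_pi p)(T).
have hP : (geq_pi p).-Hall(T) P by apply: duo_Ore_Hall.
have nPT : P <| T := pcore_normal _ _.
have pT : {in \pi(T), geq_pi p =i (p : nat_pred)}.
  move=> q Tq; have := pnatPpi (pHall_pgroup hT) Tq.
  by rewrite !inE -leqNgt eqn_leq => ->.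
have sylPT : p.-Sylow(T) P by rewrite -(eq_in_pHall _ pT).
have /splitsP[D /complP[tiPD mulPD]] := SchurZassenhaus_split (pHall_Hall hP) nPT.
have sDT : D \subset T by rewrite -mulPD mulG_subr.
have sPT := normal_sub nPT; have pP := pHall_pgroup sylPT.
have nPD : D \subset 'N(P) := subset_trans sDT (normal_norm nPT).
have eqTP : T / P = D / P by rewrite -[in LHS]mulPD quotientMidl.
have sdD : P ><| D = T by rewrite sdprodE.
have hD : (geq_pi p)^'.-Hall(T) D by apply/(sdprod_Hall_pcoreP hP).
have pi'D := pHall_pgroup hD.
have p'D : p^'.-group D.
  by apply: sub_in_pnat pi'D => q _; apply: contra => /eqnP->; apply: leqnn.
have sPG := subset_trans sPT sTG; have sDG := subset_trans sDT sTG.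
(* If the verbal subgroup of [D] centralised [P], that of [T] would be p-nilpotent, and so would
   that of [G], [K] being a p'-group. *)
have badD : ~~ (abres (m p) D \subset 'C(P)).
  apply: contra badp => cD.
  have nCT : T \subset 'N('C(P)) by rewrite norms_cent ?normal_norm.
  have sVT : abres (m p) T \subset T := abres_sub _ _.
  have hTn : pnil p (abres (m p) T).
    apply: (@pnil_extp _ _ _ [group of P]) => //=.
    - exact: subset_trans sVT (normal_norm nPT).
    - apply: pnil_p'group; apply: (pgroupS (quotientS _ sVT)).
      by rewrite /= -/P eqTP quotient_pgroup.
    move=> x Vx p'x; apply: (@pgroup_quotient_p'elt p _ (abres_group (m p) T)) Vx p'x => /=.
      have nPV : abres (m p) D \subset 'N(P) := subset_trans (abres_sub _ _) nPD.
      apply: (@pgroupS _ _ [group of (P <*> abres (m p) D) / 'C(P)]).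
        apply: quotientS; rewrite norm_joinEr // -quotientSK; last first.
          exact: subset_trans sVT (normal_norm nPT).
        have nPT' : T \subset 'N(P) := normal_norm nPT.
        rewrite !quotient_abres //.
        by apply: abresS; rewrite /= -/P eqTP.
      rewrite /= norm_joinEr // quotientMl; last exact: subset_trans sPT nCT.
      by rewrite (quotientS1 cD) mulg1 quotient_pgroup.
    exact: subset_trans sVT nCT.
  apply: (@pnil_extp' _ _ _ [group of K]) => /=.
  - exact: subset_trans (abres_sub _ _) (normal_norm nKG).
  - apply: sub_in_pnat (pHall_pgroup hK) => q _; rewrite !inE => lt_pq.
    by rewrite neq_ltn lt_pq orbT.
  have eqGK : G / K = T / K by rewrite -[in LHS]mulKT quotientMidl.
  rewrite quotient_abres ?normal_norm //= -/K eqGK -quotient_abres.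
    apply: quotient_pnil hTn; apply: subset_trans (normal_norm nKG).
    exact: subset_trans (abres_sub _ _) sTG.
  exact: subset_trans sTG (normal_norm nKG).
(* By coprime action [K] has a T-invariant Sylow subgroup for each prime, and [bad_cent] applies to
   it. *)
have cKP : K \subset 'C(P).
  apply: Sylow_cover => r Kr.
  have nKT : T \subset 'N(K) := subset_trans sTG (normal_norm nKG).
  have coKT : coprime #|K| #|T| := pnat_coprime (pHall_pgroup hK) (pHall_pgroup hT).
  have [R sylR nRT] := sol_coprime_Sylow_exists r solT nKT coKT; exists R => //.
  have [sRK rR _] := and3P sylR.
  have defPD : P <*> D = T by rewrite norm_joinEr.
  have pr_r : prime r by move: Kr; rewrite mem_primes => /and3P[].
  rewrite centsC; apply: (@bad_cent p [group of P] D) rR _ _ _ => //=; last by rewrite defPD.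
    exact: subset_trans sKG.
  rewrite defPD; apply: sub_in_pnat (pHall_pgroup hT) => q _.
  apply: contra => /eqnP->; exact: (pnatPpi (pHall_pgroup hK) Kr).
have nPG : P <| G.
  rewrite /normal sPG -mulKT mul_subG //; last exact: normal_norm.
  exact: subset_trans cKP (cent_sub P).
have sylP : p.-Sylow(G) P.
  apply: subHall_Sylow hT _ sylPT.
  by rewrite !inE -leqNgt.
exists D; rewrite (normal_Hall_pcore sylP nPG); split=> //.
Qed.

Definition bad : nat_pred := [pred p | prime p && ~~ pnil p (abres (m p) G)].

Lemma badP p : p \in bad ->
  exists D, [/\ prime p, p.-Sylow(G) 'O_p(G), D \subset G,
                p^'.-group D /\ (geq_pi p)^'.-group D
              & ~~ (abres (m p) D \subset 'C('O_p(G)))].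
Proof.
by case/andP=> pr_p /(bad_structure pr_p)[D [sylP sDG p'D piD badD]]; exists D.
Qed.

Lemma bad_Sylow p : p \in bad -> p.-Sylow(G) 'O_p(G).
Proof. by case/badP=> D []. Qed.

Lemma bad_pcore_comm p : p \in bad ->
  exists D, [/\ D \subset G, p^'.-group D & [~: 'O_p(G), abres (m p) D] = 'O_p(G)].
Proof.
case/badP=> D [pr_p sylP sDG [p'D _] badD]; exists D; split=> //.
apply: (@bad_comm p [group of 'O_p(G)]) => //=; rewrite ?pcore_sub ?pcore_pgroup //.
exact: subset_trans sDG (gFnorm _ G).
Qed.

Lemma bad_pcore_ntriv p : p \in bad -> 'O_p(G) != 1.
Proof. by case/badP=> D [_ _ _ _]; apply: contraNneq => ->; apply: cents1. Qed.

Lemma bad_pcore_Phi p S : p \in bad -> 'Phi('O_p(G)) \subset S ->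
  S \proper 'O_p(G) -> G \subset 'N(S) -> S \subset 'Phi('O_p(G)).
Proof.
case/badP=> D [pr_p sylP sDG [p'D _] badD] sPhiS prSP nSG.
apply: (@bad_irreducible p [group of 'O_p(G)] D) => //=; rewrite ?pcore_sub ?pcore_pgroup //.
- exact: subset_trans sDG (gFnorm _ G).
- exact: proper_sub prSP.
- exact: subset_trans nSG.
- by have:= prSP; rewrite properEneq => /andP[].
Qed.

Lemma pcore_bad_Hall : bad.-Hall(G) 'O_bad(G).
Proof.
rewrite /pHall pcore_sub pcore_pgroup /=; apply/pnatP=> // q pr_q q_dvd.
rewrite inE; apply/negP=> bad_q; have sylQ := bad_Sylow bad_q.
have sQA : 'O_q(G) \subset 'O_bad(G).
  by apply: sub_pcore => r /eqnP->.
have /and3P[_ _ q'i] := sylQ.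
have := pnat_dvd (indexgS _ sQA) q'i; rewrite p'natE // => /negP; apply.
exact: q_dvd.
Qed.

Lemma pcore_bad_nil : nilpotent 'O_bad(G).
Proof.
suff sAF : 'O_bad(G) \subset 'F(G) by apply: nilpotentS sAF (Fitting_nil G).
apply: Sylow_cover => q Aq.
have bad_q : q \in bad := pnatPpi (pcore_pgroup bad G) Aq.
exists ('O_q(G))%G => /=; last first.
  by rewrite Fitting_max ?pcore_normal ?(pgroup_nil (pcore_pgroup q G)).
apply: pHall_subl (bad_Sylow bad_q); last exact: pcore_sub.
by apply: sub_pcore => r /eqnP->.
Qed.

(** A bad prime does not divide the order of the quotient, and for a good prime p-nilpotency passes
    to it. *)
Lemma formation_quotient_bad : F _ (G / 'O_bad(G))%G.
Proof.
apply/FP; split=> [|p pr_p]; first exact: quotient_sol.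
have nAG : G \subset 'N('O_bad(G)) by apply: gFnorm.
have [bad_p | good_p] := boolP (p \in bad).
  apply: pnil_p'group; apply: pgroupS (abres_sub _ _) _.
  rewrite /pgroup card_quotient //; have /and3P[_ _ bad'] := pcore_bad_Hall.
  by apply: sub_in_pnat bad' => q _; apply: contra => /eqnP->.
rewrite -quotient_abres //; apply: quotient_pnil.
  exact: subset_trans (abres_sub _ _) nAG.
by move: good_p; rewrite inE pr_p negbK.
Qed.

(** For the lower bound, ['O_p(G)] equals its commutator with the p'-group [abres (m p) D], which
    centralises it modulo the residual because [G / residual F G] is in [F]. *)
Lemma residual_bad : residual F G = 'O_bad(G)%G.
Proof.
apply: val_inj; apply/eqP; rewrite eqEsubset /=.
rewrite (residual_sub_normal (pcore_normal bad G) formation_quotient_bad) /=.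
have FR : F _ (G / residual F G)%G by apply: formation_quotient_self.
have nRG : G \subset 'N(residual F G) by apply: normal_norm; apply: residual_normal.
apply: Sylow_cover => p Ap.
have bad_p : p \in bad := pnatPpi (pcore_pgroup bad G) Ap.
have pr_p : prime p by case/andP: bad_p.
exists ('O_p(G))%G => /=.
  apply: pHall_subl (bad_Sylow bad_p); last exact: pcore_sub.
  by apply: sub_pcore => r /eqnP->.
have [D [sDG p'D defP]] := bad_pcore_comm bad_p.
have nRP : 'O_p(G) \subset 'N(residual F G) := subset_trans (pcore_sub _ _) nRG.
have sVG : abres (m p) D \subset G := subset_trans (abres_sub _ _) sDG.
rewrite -defP -quotient_cents2 //; last exact: subset_trans nRG.
rewrite centsC; apply/subsetP=> _ /morphimP[x Nx Vx ->].
apply: (@formation_abres_cent F m FP p _ (G / residual F G) _ _ pr_p FR).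
- by apply: quotient_normal; apply: pcore_normal.
- by apply: quotient_pgroup; apply: pcore_pgroup.
- rewrite -quotient_abres //; apply: mem_quotient.
  by apply: subsetP Vx; apply: abresS.
- apply: morph_p_elt => //; apply: mem_p_elt Vx.
  exact: pgroupS (abres_sub _ _) p'D.
Qed.

Lemma bad_minnormal p : p \in bad -> 'Phi('O_p(G)) = 1 -> minnormal 'O_p(G) G.
Proof.
move=> bad_p Phi1; apply/mingroupP; rewrite bad_pcore_ntriv // gFnorm; split=> //.
move=> H /andP[ntH nHG] sHP; apply/eqP; rewrite eqEproper sHP /=.
apply: contra ntH => prHP; rewrite -subG1 -Phi1.
by apply: bad_pcore_Phi; rewrite ?Phi1 ?sub1G.
Qed.

Lemma bad_chief p : p \in bad -> chief_factor G 'Phi('O_p(G)) 'O_p(G).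
Proof.
move=> bad_p; rewrite /chief_factor pcore_normal andbT; apply/maxgroupP.
have prPhi : 'Phi('O_p(G)) \proper 'O_p(G) by apply: Phi_proper; apply: bad_pcore_ntriv.
split; first by rewrite prPhi !gFnorm_trans ?gFnorm.
move=> H /andP[prHP nHG] sPhiH; apply/eqP; rewrite eqEsubset sPhiH andbT.
exact: bad_pcore_Phi.
Qed.

(** Otherwise the p'-group [abres (m p) D] would centralise [P / 'Phi(P)], and [P =
    [~: P, abres (m p) D]] would lie in ['Phi(P)]. *)
Lemma bad_eccentric p : p \in bad ->
  ~ p.-group (abres (m p) (G / 'C_G('O_p(G) / 'Phi('O_p(G)) | 'Q))).
Proof.
move=> bad_p; set P := 'O_p(G); set C := 'C_G(_ | 'Q).
have nPhiG : G \subset 'N('Phi(P)) by rewrite !gFnorm_trans ?gFnorm.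
have nCG : C <| G by apply: astabQ_normal => //; apply: gFnorm.
rewrite -quotient_abres ?normal_norm // => pV.
have [D [sDG p'D defP]] := bad_pcore_comm bad_p.
have sVC : abres (m p) D \subset C.
  apply/subsetP=> x Vx.
  apply: (@pgroup_quotient_p'elt p _ (abres_group (m p) G) [group of C]) => //=.
  - exact: subset_trans (abres_sub _ _) (normal_norm nCG).
  - by apply: subsetP Vx; apply: abresS.
  - by apply: mem_p_elt Vx; apply: pgroupS (abres_sub _ _) p'D.
have prPhi : 'Phi(P) \proper P by apply: Phi_proper; apply: bad_pcore_ntriv.
case/negP: (proper_subn prPhi).
suff: [~: P, abres (m p) D] \subset 'Phi(P) by rewrite defP.
rewrite commGC -astabQ_cent.
- exact: subset_trans sVC (subsetIr _ _).
- by apply: subset_trans nPhiG; apply: subset_trans sDG; apply: abres_sub.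
- exact: subset_trans (pcore_sub _ _) nPhiG.
Qed.

(* If Phi(P) <> 1, the chain R E < R E Phi(P) < R E P puts R E in F for every
   p'-subgroup E of D of order divisible by at most two primes. *)
Lemma bad_unique p r : p \in bad -> r \in bad -> r != p -> 'Phi('O_p(G)) = 1.
Proof.
move=> bad_p bad_r neq_rp; have [D [pr_r sylR sDG [r'D _] badD]] := badP bad_r.
have pr_p : prime p by case/andP: bad_p.
apply/eqP; apply: contraR badD => ntPhi.
set R := 'O_r(G); set P := 'O_p(G) in ntPhi *.
have [nRG nPG] : G \subset 'N(R) /\ G \subset 'N(P) by rewrite !gFnorm.
have [rR pP] : r.-group R /\ p.-group P by rewrite !pcore_pgroup.
have p'R : p^'.-group R.
  by apply: sub_in_pnat rR => q _ /eqnP->; rewrite !inE.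
have cPR : P \subset 'C(R).
  apply: (@coprime_normal_cent _ G [group of P] [group of R]); rewrite ?pcore_normal //.
  exact: pnat_coprime pP p'R.
have ab2 E : E \subset D -> size (primes #|E|) <= 2 -> abres (m r) E \subset 'C(R).
  move=> sED le2; have sEG := subset_trans sED sDG; set N := P :&: E.
  (* The order of [E] may be divisible by [p]; its Sylow p-subgroup [N] lies in [P] and centralises
     [R], so a complement [E1] induces the same action on [R]. *)
  have hN : p.-Hall(E) N by apply: setI_normal_Hall (bad_Sylow bad_p) sEG; apply: pcore_normal.
  have nNE : N <| E by rewrite /N setIC; apply: normalGI (pcore_normal p G).
  have /splitsP[E1 /complP[tiNE1 mulNE1]] := SchurZassenhaus_split (pHall_Hall hN) nNE.
  have sE1E : E1 \subset E by rewrite -mulNE1 mulG_subr.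
  have sdE : N ><| E1 = E by rewrite sdprodE // (subset_trans sE1E) ?normal_norm.
  have coNE1 : coprime #|N| #|E1|.
    rewrite (coprime_sdprod_Hall_l sdE); exact: pHall_Hall hN.
  have p'E1 : p^'.-group E1.
    have /and3P[_ _] := hN; rewrite -divgS ?subsetIr // -mulNE1 TI_cardMg //.
    by rewrite mulKn.
  have sE1G := subset_trans sE1E sEG.
  have nRE1 := subset_trans sE1G nRG.
  pose X := (R <*> E1)%G.
  have sXG : X \subset G by rewrite join_subG pcore_sub.
  have p'X : p^'.-group X by rewrite /= norm_joinEr // pgroupM p'R.
  have nPX := subset_trans sXG nPG.
  have nPhiX : X \subset 'N('Phi(P)) by apply: subset_trans sXG _; rewrite !gFnorm_trans ?gFnorm.
  have coPX : coprime #|P| #|X| := pnat_coprime pP p'X.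
  have FX : F _ X.
    apply: (formation_size4 (M := ('Phi(P) <*> X)%G) (L := (P <*> X)%G)).
    - rewrite properE joing_subr join_subG subxx andbT /=.
      apply: contra ntPhi => sPhiX.
      by rewrite -subG1 -(coprime_TIg coPX) subsetI sPhiX Phi_sub.
    - by apply: proper_join nPhiX nPX coPX _; apply: Phi_proper; apply: bad_pcore_ntriv.
    - by rewrite join_subG pcore_sub.
    apply: leq_trans (size_primes_join nPX) _.
    rewrite -[4]/(1 + 3)%N leq_add ?(size_primes_pgroup pP) //.
    apply: leq_trans (size_primes_join nRE1) _.
    rewrite -[3]/(1 + 2)%N leq_add ?(size_primes_pgroup rR) //.
    exact: leq_trans (size_primesS sE1E) le2.
  have cE1 : abres (m r) E1 \subset 'C(R).
    apply: (abres_join_cent pr_r rR _ nRE1 FX).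
    by apply: pgroupS r'D; apply: subset_trans sED.
  have nCE : E \subset 'N('C(R)) by apply: norms_cent; apply: subset_trans nRG.
  have eqE : E / 'C(R) = E1 / 'C(R).
    rewrite -mulNE1 quotientMl; last by apply: subset_trans nCE; apply: subsetIr.
    by rewrite quotientS1 ?mul1g // (subset_trans _ cPR) ?subsetIl.
  rewrite -quotient_sub1; last exact: subset_trans (abres_sub _ _) nCE.
  rewrite quotient_abres //= eqE -quotient_abres ?quotientS1 //.
  exact: subset_trans nCE.
apply: abres_biprimary_cent => //; first exact: subset_trans nRG.
- exact: solvableS solG.
- by move=> E sED le1; apply: ab2 => //; apply: leqW.
- by move=> E sED le2; apply: subset_trans (ab2 E sED le2); apply: der1_sub_abres.
Qed.

Lemma bad_special p : p \in bad -> 'Phi('O_p(G)) != 1 ->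
  special 'O_p(G) /\ exponent 'O_p(G) = p.
Proof.
move=> bad_p ntPhi; have [D [pr_p sylP sDG [p'D piD] badD]] := badP bad_p.
pose P := ('O_p(G))%G; have pP : p.-group P := pcore_pgroup p G.
have sPG : P \subset G := pcore_sub p G.
have nPD : D \subset 'N(P) := subset_trans sDG (gFnorm _ G).
set L := abres (m p) D in badD.
have sLD : L \subset D := abres_sub _ _.
have nPL := subset_trans sLD nPD.
have coPL : coprime #|P| #|L| := pnat_coprime pP (pgroupS sLD p'D).
have defP : [~: P, L] = P by apply: bad_comm.
have cL S : S \proper P -> D \subset 'N(S) -> L \subset 'C(S) by apply: abres_cent_proper.
have cLchar S : S \char P -> S :!=: P -> L \subset 'C(S).
  move=> chS neS; apply: cL; first by rewrite properEneq neS char_sub.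
  exact: char_norm_trans chS nPD.
have ntP : P :!=: 1 := bad_pcore_ntriv bad_p.
(* All prime divisors of [#|D|] are below [p], so [p = 2] would leave [D] trivial. *)
have odd_p : odd p.
  case: (even_prime pr_p) => // p2; case/negP: badD.
  suff D1 : D :=: 1 by apply: subset_trans sLD _; rewrite D1 sub1G.
  apply: card1_trivg; apply: (@pnat_1 (geq_pi p)); last exact: piD.
  by apply/pnatP=> // q pr_q _; rewrite inE p2 prime_gt1.
(* If [P] is abelian, coprime action gives ['C_P(L) = 1], so [L] cannot centralise ['Ohm_1(P)],
   which must then be all of [P]. *)
have nabP : ~~ abelian P.
  apply: contra ntPhi => abP; rewrite (trivg_Phi pP).
  have [eqO | neO] := eqVneq 'Ohm_1(P) P.
    by rewrite -[gval P]eqO Ohm1_abelem.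
  have cO := cLchar _ (Ohm_char 1 P) neO.
  have := coprime_abel_cent_TI nPL coPL abP; rewrite defP => C1.
  have : 'Ohm_1(P) == 1 by rewrite -subG1 -C1 subsetI Ohm_sub centsC.
  by rewrite Ohm1_eq1 (negPf ntP).
(* [L] centralises the characteristic abelian subgroups of [P], all of them proper; together with
   [[~: P, L] = P] this makes [P] special. *)
have [spP _] : special P /\ 'C_P(L) = 'Z(P).
  apply: abelian_charsimple_special pP coPL defP _.
  apply/bigcupsP=> S /andP[chS abS]; rewrite centsC; apply: cLchar => //.
  by apply: contraNneq nabP => <-.
split=> //; have [defPhi defP'] := spP.
have abZ := center_special_abelem pP spP.
have cPhi : L \subset 'C('Phi(P)).
  apply: cLchar; first exact: Phi_char.
  by rewrite /= defPhi; apply: contraNneq nabP => /center_idP.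
(* The p-th powers of x and x ^ l agree since L centralises Phi(P), and P has
   class 2 with P' of exponent p, so the commutators [~ x, l] have order p. *)
have ohmP : 'Ohm_1(P) = P.
  apply/eqP; rewrite eqEsubset Ohm_sub /=.
  suff: [~: P, L] \subset 'Ohm_1(P) by rewrite defP.
  rewrite gen_subG; apply/subsetP=> _ /imset2P[x l Px Ll ->].
  rewrite /= (OhmE 1 pP) mem_gen // inE; set y := [~ x, l].
  have Py : y \in P by rewrite -defP mem_commg.
  have Zyx : [~ y, x] \in 'Z(P) by rewrite -defP' mem_commg.
  have /centerP[_ czP] := Zyx.
  have Phix : x ^+ p \in 'Phi(P).
    by rewrite (Phi_joing pP) mem_gen // inE (Mho_p_elt 1) ?orbT ?(mem_p_elt pP).
  have xlE : x ^ l = x * y by rewrite /y commgEl mulKVg.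
  have eq_xp : (x ^ l) ^+ p = x ^+ p.
    by rewrite -conjXg /conjg -(centsP cPhi _ Ll _ Phix) mulKg.
  rewrite Py expn1 inE; apply/eqP; apply: (mulgI (x ^+ p)); rewrite mulg1.
  have [cyz cxz] : commute y [~ y, x] /\ commute x [~ y, x].
    by split; apply: commute_sym; apply: czP.
  (* Class 2 gives [(x y)^p = x^p y^p [y, x]^C(p, 2)], and an odd [p] divides the binomial
     coefficient. *)
  rewrite -[RHS]eq_xp xlE [RHS]expMg_Rmul //.
  have /and3P[_ _ expZ] := abZ.
  have -> : [~ y, x] ^+ 'C(p, 2) = 1.
    by rewrite bin2odd // expgM (exponentP expZ _ Zyx) expg1n.
  by rewrite mulg1.
have := exponent_Ohm1_class2 odd_p pP; rewrite nil_class2 defP' subxx ohmP => /(_ isT).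
case/primeP: pr_p => _ pdiv /pdiv /orP[|/eqP //].
by rewrite -dvdn1 -trivg_exponent (negPf ntP).
Qed.

End Structure.

(** * The two directions of the equivalence *)

Lemma bigdprod_nilpotent (gT : finGroupType) (I : finType)
    (N : I -> {group gT}) (A : {group gT}) :
  (forall i, nilpotent (N i)) -> \big[dprod/1]_i N i = A -> nilpotent A.
Proof.
move=> nilN; elim/big_rec: _ (A) => [B <-|i B _ IHB C defC]; first exact: nilpotent1.
have [[_ K _ defB] _ _ _] := dprodP defC.
by rewrite (dprod_nil defC) nilN defB IHB.
Qed.

Theorem theoremB (F : group_class) (f : nat -> group_class)
  (formF : formation F) (satF : saturated F)
  (nilF : sub_class nilpotent_groups F) (superF : sub_class F supersoluble)
  (canF : canonical_satellite F f)
  (n : nat) (n_gt0 : 0 < n)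
  (gT : finGroupType) (G : {group gT}) (solG : solvable G)
  (piG : n.+1 <= size (primes #|G|)) :
  (forall H : {group gT}, n_maximal n H G -> F_subnormal F G H) <->
  (F _ G \/
   let A := residual F G in
   (exists B : {group gT}, [/\ A ><| B = G, Hall G A & Hall G B]) /\
   Ore_dispersive G /\
   ((exists t : nat, exists N : 'I_t -> {group gT},
       \big[dprod/1]_(i < t) N i = A /\
       forall i : 'I_t, minnormal (N i) G /\ Sylow G (N i))
    \/
    (exists p : nat,
       [/\ prime p, p.-Sylow(G) A, exponent A = p, special A
         & eccentric_chief f G A 'Phi(A)%G])) /\
   (forall H : {group gT}, n_maximal n H G ->
      F _ H /\
      forall p : nat, prime p -> p %| #|A| ->
      forall P : {group gT}, p.-Sylow(A) P -> f p _ (H / 'C_H(P))%G)).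
Proof.
have [_ LFf _ _] := canF.
have F1 aT : F _ [1 aT]%G by apply: nilpotent_formation_trivg.
(* One exponent [m p] for each prime [p]; at other numbers the value 1 is a placeholder. *)
have /choice[m mP] (p : nat) : exists d, prime p -> d %| p.-1 /\
    forall (aT : finGroupType) (X : {group aT}), f p _ X <-> p.-group (abres d X).
  have [pr_p | npr_p] := boolP (prime p); last by exists 1%N.
  by have [d d_dvd fP] := satellite_abresP nilF superF canF pr_p; exists d.
have m_dvd p : prime p -> m p %| p.-1 by case/mP.
have fP p (pr_p : prime p) := (mP p pr_p).2.
have solF aT (X : {group aT}) : F _ X -> solvable X by move/superF/supersoluble_sol.
have FP aT (X : {group aT}) :
    F _ X <-> solvable X /\ forall p, prime p -> pnil p (abres (m p) X).
  split=> [FX | [solX hX]]; last exact: (pnil_formation LFf fP solX hX).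
  split=> [|p pr_p]; first exact: solF.
  exact: (formation_pnil formF F1 solF LFf fP pr_p FX).
set A := residual F G.
have nAG : A <| G by apply: residual_normal.
have FGA : F _ (G / A)%G by apply: formation_quotient_self.
split=> [snG | [FG | [_ [_ [structA maxH]]]] H nH]; last 2 first.
- apply: (F_subnormal_over formF F1 FP (A := 1%G) (normal1 G)).
  + exact: (formation_quotient formF F1) FG (normal1 G).
  + exact: sub1G.
  + exact: n_maximal_sub nH.
- have nilA : nilpotent A.
    case: structA => [[t [N [defA sylN]]] | [p [_ sylA _ _ _]]].
      apply: bigdprod_nilpotent defA => i.
      by have [_ /andP[/p_groupP[p _ pN] _]] := sylN i; apply: pgroup_nil pN.
    exact: pgroup_nil (pHall_pgroup sylA).
  have sHG := n_maximal_sub nH.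
  have nAH := subset_trans sHG (normal_norm nAG).
  have sAHG : A <*> H \subset G by rewrite join_subG normal_sub.
  (* [A H] is F-subnormal in [G] as an overgroup of the residual, and [H] is F-subnormal in [A H]
     because [A H] is in [F]. *)
  apply: (@F_subnormal_trans F _ G H (A <*> H)%G); last first.
    by apply: (F_subnormal_over formF F1 FP nAG FGA); rewrite ?joing_subl.
  have FAH : F _ (A <*> H)%G.
    apply: (@formation_nilpotent_mul F m FP _ _ A H) => //.
    + exact: solvableS solG.
    + by rewrite /normal joing_subl join_subG normG.
    + by rewrite /= norm_joinEr.
    + by apply: (formationS FP) FGA; apply: quotientS.
    move=> p pr_p p_dvd x Vx p'x; have [_ /(_ p pr_p p_dvd 'O_p(A)%G)] := maxH H nH.
    move=> /(_ (nilpotent_pcore_Hall p nilA)) /(fP p pr_p) pV.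
    have nCH : H \subset 'N('C_H('O_p(A))).
      rewrite normsI ?normG // norms_cent //; apply: subset_trans sHG _.
      by apply: normal_norm; apply: gFnormal_trans nAG.
    rewrite -quotient_abres // in pV.
    have := @pgroup_quotient_p'elt p _ (abres_group (m p) H) _ x pV _ Vx p'x.
    rewrite inE => /(_ _)/andP[|_] //.
    exact: subset_trans (abres_sub _ _) nCH.
  apply: (F_subnormal_over formF F1 FP (A := 1%G) (normal1 _)).
  + exact: (formation_quotient formF F1) FAH (normal1 _).
  + exact: sub1G.
  + exact: joing_subr.
(* From here on [n = k + 1], and every subgroup of a k-maximal subgroup is in [F]. *)
case: n n_gt0 piG snG => // k _ piG snG; right.
have deepF (H : {group gT}) : deep k H G -> F _ H.
  exact: (F_subnormal_deep formF F1 satF FP).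
have oG : duo_Ore G := duo_Ore_structure FP m_dvd solG piG deepF.
have defA : A = 'O_(bad m G)(G)%G :=
  residual_bad formF F1 FP superF m_dvd solG piG deepF.
have hA : (bad m G).-Hall(G) A.
  by rewrite defA; apply: (pcore_bad_Hall formF F1 FP superF m_dvd solG piG deepF).
have nilA : nilpotent A.
  by rewrite defA; apply: (pcore_bad_nil formF F1 FP superF m_dvd solG piG deepF).
have badA p : p \in primes #|A| -> p \in bad m G by apply: pnatPpi (pHall_pgroup hA).
have sylA p : p \in primes #|A| -> 'O_p(A) = 'O_p(G).
  move=> Ap; have sylA := nilpotent_pcore_Hall p nilA.
  have sylG := subHall_Sylow hA (badA p Ap) sylA.
  by rewrite (normal_Hall_pcore sylG) //; apply: gFnormal_trans nAG.
split.
  have /splitsP[B /complP[tiAB mulAB]] := SchurZassenhaus_split (pHall_Hall hA) nAG.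
  have sBG : B \subset G by rewrite -mulAB mulG_subr.
  have sdAB : A ><| B = G by rewrite sdprodE // (subset_trans sBG) ?normal_norm.
  have hallA := pHall_Hall hA; exists B; split=> //.
  by rewrite -(coprime_sdprod_Hall_r sdAB) (coprime_sdprod_Hall_l sdAB).
split; first exact: duo_Ore_dispersive.
split; last first.
  move=> H nH; have sHG := n_maximal_sub nH.
  have snH := snG H nH.
  have FH : F _ H.
    by apply: deepF; apply: (@deep_leq _ _ k.+1) => //; exists H.
  split=> // p pr_p p_dvd P sylP; apply/fP => //=.
  have Ap : p \in primes #|A| by rewrite mem_primes pr_p cardG_gt0.
  have nPG : P <| G.
    by rewrite (eq_Hall_pcore (nilpotent_pcore_Hall p nilA) sylP) gFnormal_trans.
  have pP := pHall_pgroup sylP.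
  have nCH : H \subset 'N('C_H(P)).
    by rewrite normsI ?normG ?norms_cent // (subset_trans sHG) ?normal_norm.
  rewrite -quotient_abres //; apply: p'elt_pgroup_quotient.
    exact: subset_trans (abres_sub _ _) nCH.
  move=> x Vx p'x; rewrite inE (subsetP (abres_sub _ _) x Vx) /=.
  (* [x] centralises [H :&: P] as [H] is in [F], and F-subnormality carries this up to [P]. *)
  apply: (F_subnormal_abres_cent FP pr_p snH nPG pP Vx p'x).
  apply: (formation_abres_cent FP pr_p FH _ _ Vx p'x).
    exact: normalGI nPG.
  by apply: pgroupS pP; apply: subsetIr.
(* The two forms of [A] are told apart by whether all its Sylow subgroups have trivial Frattini
   subgroup. *)
have [allPhi | ] := boolP (all (fun p : nat => 'Phi('O_p(G)) == 1) (primes #|A|)).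
  left; exists (size (primes #|A|)).
  exists (fun i => 'O_(nth 0%N (primes #|A|) i)(A))%G; split=> [|i] /=.
    (* A nilpotent group is its own Fitting subgroup, the direct product of its p-cores. *)
    by rewrite -[RHS](nilpotent_Fitting nilA) /Fitting (big_nth 0%N) big_mkord.
  set p := nth _ _ _; have Ap : p \in primes #|A| by apply: mem_nth.
  rewrite sylA //; have bad_p := badA p Ap; split.
    apply: (bad_minnormal formF F1 FP superF m_dvd solG piG deepF bad_p).
    by apply/eqP/(allP allPhi).
  by apply: p_Sylow; apply: (bad_Sylow formF F1 FP superF m_dvd solG piG deepF).
case/allPn=> p Ap ntPhi; right; exists p; have bad_p := badA p Ap.
have pr_p : prime p by case/andP: bad_p.
(* A second bad prime would force ['Phi('O_p(G))] to be trivial, so [A] is a p-group. *)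
have defAp : A = 'O_p(G)%G.
  apply: val_inj; rewrite /= -sylA // pcore_pgroup_id //.
  apply/pgroupP=> r pr_r r_dvd; rewrite inE; apply: contraR ntPhi => neq_rp.
  have Ar : r \in primes #|A| by rewrite mem_primes pr_r cardG_gt0.
  apply/eqP.
  exact: (bad_unique formF F1 FP superF m_dvd solG piG deepF bad_p (badA r Ar) neq_rp).
have [spP expP] := bad_special formF F1 FP superF m_dvd solG piG deepF bad_p ntPhi.
rewrite defAp; split=> //.
  exact: (bad_Sylow formF F1 FP superF m_dvd solG piG deepF).
split; first exact: (bad_chief formF F1 FP superF m_dvd solG piG deepF).
case=> _ /(_ p pr_p) cen.
apply: (bad_eccentric formF F1 FP superF m_dvd solG piG deepF bad_p).
apply/(fP p pr_p)/cen.
have ntP : 'O_p(G) / 'Phi('O_p(G)) != 1.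
  rewrite -subG1 quotient_sub1 ?gFnorm // proper_subn // Phi_proper //.
  exact: (bad_pcore_ntriv formF F1 FP superF m_dvd solG piG deepF).
by have [_ ->] := pgroup_pdiv (quotient_pgroup _ (pcore_pgroup p G)) ntP.
Qed.
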